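(* Let $F$ be a finite simple graph and let $G$ be a $k$-fold cover of $F$. Then (a) if $F$ is $3$-regular, $\gamma(G) \geq \frac{3}{5}\,k\,\gamma(F)$; (b) if $F$ is $4$-regular or $5$-regular, $\gamma(G) \geq \frac{1}{2}\,k\,\gamma(F)$.
   Context: All graphs are finite, simple and undirected. A graph $G$ is a cover of a graph $F$ if there is an onto map $\pi: V(G)\to V(F)$ such that for every vertex $v$ of $G$, $\pi$ maps the neighbours of $v$ in $G$ bijectively onto the neighbours of $\pi(v)$ in $F$; the cover is $k$-fold if every fibre $\pi^{-1}(u)$ has exactly $k$ vertices. $\gamma(\cdot)$ denotes the domination number: the minimum size of a set $S$ of vertices such that every vertex not in $S$ has a neighbour in $S$. *)

(* Defs.v *)
From mathcomp Require Import all_boot.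
Set Implicit Arguments. Unset Strict Implicit. Unset Printing Implicit Defensive.

Definition simple_graph (T : finType) (e : rel T) : Prop :=
  symmetric e /\ irreflexive e.

Definition nbhd (T : finType) (e : rel T) (v : T) : {set T} := [set u | e v u].

Definition regular (T : finType) (e : rel T) (d : nat) : Prop :=
  forall v : T, #|nbhd e v| = d.

Definition dominating (T : finType) (e : rel T) (S : {set T}) : bool :=
  [forall x, (x \notin S) ==> [exists y in S, e x y]].

(* domination number: minimum size of a dominating set.  The whole vertex
   set is always dominating (size #|T|), so using #|T| as the neutral element
   of minn gives exactly the minimum. *)
Definition domination_number (T : finType) (e : rel T) : nat :=
  \big[minn/#|T|]_(S : {set T} | dominating e S) #|S|.

Definition cover_map (TG TF : finType) (eG : rel TG) (eF : rel TF)
  (pi : TG -> TF) : Prop :=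
  (forall u : TF, exists v : TG, pi v = u) /\
  (forall v : TG,
     {in nbhd eG v &, injective pi} /\ pi @: nbhd eG v = nbhd eF (pi v)).

Definition kfold (TG TF : finType) (pi : TG -> TF) (k : nat) : Prop :=
  forall u : TF, #|[set v | pi v == u]| = k.

(* Main.v *)
Require Import Defs.
From mathcomp Require Import all_boot.
From mathcomp Require Import zify.
Set Implicit Arguments. Unset Strict Implicit. Unset Printing Implicit Defensive.

(** Summing closed neighbourhoods, a dominating set [S] of the [d]-regular graph [G]
    satisfies [(d+1) |S| >= |G| = k |F|], so it suffices to bound the domination number
    of a [d]-regular graph on [n] vertices by [5n/12], [2n/5] and [n/3] for [d = 3, 4, 5].

    Vertices are picked one after another.  A vertex that is not yet dominated ("white")
    has weight [w], and a dominated ("blue") vertex with [i] white neighbours has weight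
    [b i], where [b] is concave with [b 0 = 0].  Every vertex starts with weight [w], so
    it is enough to find, as long as a white vertex remains, some [m] vertices whose
    choice lowers the total weight by at least [N m]; then [N |S| <= w n] in the end.

    - A vertex with the largest number of white vertices in its closed neighbourhood will
      do while that number is at least 4.
    - Below 4 the white vertices induce paths and cycles.  A vertex next to the end of a
      path will do, and so will one or two vertices of a cycle, except in a 4-cycle, where
      blue vertices adjacent to the cycle have to be taken into account.
    - Once no closed neighbourhood contains more than two white vertices, take a maximum
      matching between white vertices at distance at most 2, dominate every matched pair
      by one vertex and let every unmatched white vertex dominate itself.  The absence of
      augmenting paths bounds the number of unmatched vertices by discharging. *)

Lemma leq_sum_in (I : eqType) (r : seq I) (F1 F2 : I -> nat) :
  {in r, forall i, F1 i <= F2 i} -> \sum_(i <- r) F1 i <= \sum_(i <- r) F2 i.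
Proof.
elim: r => [|i r IHr] leF; first by rewrite !big_nil.
rewrite !big_cons leq_add ?leF ?mem_head // IHr // => j rj.
by rewrite leF // inE rj orbT.
Qed.

(** * Weights and the loss of weight caused by picking one vertex *)

Section Potential.
Variables (T : finType) (e : rel T) (d : nat).
Hypotheses (e_sym : symmetric e) (e_irr : irreflexive e) (ereg : regular e d).

Definition cadj (x y : T) := (x == y) || e x y.
Definition cnbhd (x : T) : {set T} := [set y | cadj x y].

Lemma cadjC : symmetric cadj.
Proof. by move=> x y; rewrite /cadj eq_sym e_sym. Qed.

Lemma cadjxx x : cadj x x.
Proof. by rewrite /cadj eqxx. Qed.

Lemma card_cnbhd x : #|cnbhd x| = d.+1.
Proof.
have -> : cnbhd x = x |: nbhd e x by apply/setP=> y; rewrite !inE /cadj eq_sym.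
by rewrite cardsU1 ereg inE e_irr.
Qed.

(* [W] always stands for the set of vertices that are not yet dominated. *)
Definition wnb (W : {set T}) (x : T) : {set T} := cnbhd x :&: W.
Definition wdeg (W : {set T}) (x : T) : nat := #|wnb W x|.

Lemma in_wnb W x y : (y \in wnb W x) = cadj x y && (y \in W).
Proof. by rewrite !inE. Qed.

Lemma wnb_sym (W : {set T}) x y : x \in W -> y \in wnb W x -> x \in wnb W y.
Proof. by move=> Wx; rewrite !in_wnb Wx cadjC andbT => /andP[]. Qed.

Lemma wdegS (W1 W2 : {set T}) x : W1 \subset W2 -> wdeg W1 x <= wdeg W2 x.
Proof. by move=> sW; rewrite subset_leq_card // setIS. Qed.

Lemma wdeg_split (W : {set T}) v x :
  wdeg W x = wdeg (W :\: cnbhd v) x + #|wnb W v :&: cnbhd x|.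
Proof.
rewrite /wdeg -(cardsID (cnbhd v) (wnb W x)) addnC; congr (_ + _); apply: eq_card => y.
  by rewrite !inE; case: (cadj v y); rewrite ?andbF.
by rewrite !inE; case: (cadj v y); case: (cadj x y); case: (y \in W).
Qed.

Lemma uniq_leq_card (A : {set T}) s : uniq s -> {subset s <= A} -> size s <= #|A|.
Proof. by move=> us sA; rewrite cardE uniq_leq_size // => x /sA; rewrite mem_enum. Qed.

Lemma exists_notin (A : {set T}) s : size s < #|A| -> exists2 x, x \in A & x \notin s.
Proof.
move=> ltA; apply/subsetPn/negP => /subset_leq_card; rewrite leqNgt => /negP[].
exact: leq_ltn_trans (card_size s) ltA.
Qed.

Lemma uniq_eq_card (A : {set T}) s :
  uniq s -> {subset s <= A} -> #|A| <= size s -> A =i s.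
Proof.
move=> us sA leA x; have sE : {subset s <= enum A} by move=> y /sA; rewrite mem_enum.
have sizeE : size (enum A) <= size s by rewrite -cardE.
by have [_ ->] := uniq_min_size us sE sizeE; rewrite mem_enum.
Qed.

Lemma leq_sum_subseq (A : {set T}) (F : T -> nat) (s : seq T) :
  uniq s -> {subset s <= A} -> \sum_(x <- s) F x <= \sum_(x in A) F x.
Proof.
move=> us sA; rewrite big_uniq //=.
rewrite [leqRHS](bigID (mem s)) /=.
rewrite [X in _ <= X + _](eq_bigl (mem s)) ?leq_addr // => x /=.
by rewrite andbC; case: (boolP (x \in s)) => //= /sA ->.
Qed.

Variables (w : nat) (b : nat -> nat).
Hypotheses (bmono : {homo b : i j / i <= j}) (b0 : b 0 = 0) (bw : forall i, b i <= w).

Definition weight (W : {set T}) : nat := w * #|W| + \sum_(y in ~: W) b (wdeg W y).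

(** Losing one white neighbour costs a blue vertex at least [dl], as long as it has at most [m] of
    them. The bound [m] matters because a concave [b] is flatter further out. *)
Definition has_slope (dl m : nat) := forall i j, i <= j -> j <= m -> b i + dl * (j - i) <= b j.

(* Picking [v] dominates the vertices of [wnb W v].  Each of them is credited with its own
   loss of weight and with [dl] for every neighbour outside [W], which is a lower bound for
   what that neighbour loses; [extra] is what this estimate misses at a blue vertex. *)
Definition gain dl (W : {set T}) v x :=
  w + dl * (d.+1 - wdeg W x) - b (wdeg (W :\: cnbhd v) x).

Definition extra dl (W : {set T}) v y :=
  b (wdeg W y) - b (wdeg (W :\: cnbhd v) y) - dl * #|wnb W v :&: cnbhd y|.

(** Taken over all newly dominated and all blue vertices, gains and extras sum exactly to the loss
    of weight, by double counting the adjacent pairs. The slope hypothesis keeps the truncated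
    subtraction in [extra] from truncating, and since all terms are naturals, restricting the sums
    to [s] and [t] only weakens the estimate. *)
Lemma weight_drop dl m (W : {set T}) v s t : has_slope dl m ->
  (forall y, y \notin W -> wdeg W y <= m) ->
  uniq s -> {subset s <= wnb W v} -> uniq t -> {subset t <= ~: W} ->
  weight (W :\: cnbhd v) + \sum_(x <- s) gain dl W v x + \sum_(y <- t) extra dl W v y
  <= weight W.
Proof.
move=> slope dW us sA ut tW.
have := leq_sum_subseq (gain dl W v) us sA; have := leq_sum_subseq (extra dl W v) ut tW.
set sx := \sum_(x <- s) _; set sy := \sum_(y <- t) _ => le_sy le_sx.
suff: weight (W :\: cnbhd v) + \sum_(x in wnb W v) gain dl W v x
      + \sum_(y in ~: W) extra dl W v y <= weight W by lia.
set W' := W :\: cnbhd v; set A := wnb W v.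
have gainE x : x \in A ->
    gain dl W v x + b (wdeg W' x) = w + dl * (d.+1 - wdeg W x).
  by move=> _; rewrite /gain -/W' subnK // (leq_trans (bw _)) // leq_addr.
have extraE y : y \in ~: W ->
    extra dl W v y + b (wdeg W' y) + dl * #|A :&: cnbhd y| = b (wdeg W y).
  rewrite inE => yW; have := slope _ _ (wdegS y (subsetDl W (cnbhd v))) (dW y yW).
  rewrite /extra -/A -/W' [X in X - wdeg _ _](wdeg_split W v y) -/W' -/A addKn; lia.
have cardW : #|W| = #|A| + #|W'|.
  by rewrite -(cardsID (cnbhd v) W) setIC.
have sumW' : \sum_(y in ~: W') b (wdeg W' y) =
    \sum_(y in A) b (wdeg W' y) + \sum_(y in ~: W) b (wdeg W' y).
  rewrite (bigID (mem W)) /=; congr (_ + _); apply: eq_bigl => y; rewrite !inE.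
    by case: (y \in W); rewrite ?andbF //= !andbT negbK.
  by case: (y \in W); rewrite ?andbF //= !andbT.
(* Adjacent pairs of a newly dominated [x] and a blue [y] are counted from both ends: [x] has
   [d.+1 - wdeg W x] blue neighbours. *)
have swap : \sum_(y in ~: W) #|A :&: cnbhd y| = \sum_(x in A) (d.+1 - wdeg W x).
  rewrite (eq_bigr (fun y => \sum_(x in A | y \in cnbhd x) 1)); last first.
    move=> y _; rewrite sum1dep_card; apply: eq_card => x; rewrite !inE cadjC.
    by rewrite [cadj x y]cadjC.
  rewrite (exchange_big_dep (fun x => x \in A)) /=; last by move=> y x _ /andP[].
  apply: eq_bigr => x Ax.
  rewrite sum1dep_card -(card_cnbhd x) -(cardsID W (cnbhd x)) addKn.
  by apply: eq_card => y; rewrite [LHS]inE Ax !inE.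
have : \sum_(x in A) gain dl W v x + \sum_(y in A) b (wdeg W' y) =
       w * #|A| + dl * \sum_(x in A) (d.+1 - wdeg W x).
  by rewrite -big_split (eq_bigr _ gainE) big_split sum_nat_const mulnC big_distrr.
have : \sum_(y in ~: W) extra dl W v y + \sum_(y in ~: W) b (wdeg W' y)
       + dl * \sum_(y in ~: W) #|A :&: cnbhd y| = \sum_(y in ~: W) b (wdeg W y).
  by rewrite big_distrr -!big_split; apply: eq_bigr => y /extraE.
by rewrite swap /weight sumW' cardW mulnDr; lia.
Qed.

Lemma gain_ge dl (W : {set T}) v x i j : wdeg W x <= i -> wdeg (W :\: cnbhd v) x <= j ->
  w + dl * (d.+1 - i) - b j <= gain dl W v x.
Proof.
by move=> le_i /bmono le_j; rewrite leq_sub // leq_add2l leq_mul2l leq_sub2l ?orbT.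
Qed.


(** * Matchings of the undominated vertices *)

Definition dominates (S W : {set T}) := forall x, x \in W -> exists2 y, y \in S & cadj x y.

Definition linked (p q : T) := [exists s, cadj s p && cadj s q].

Lemma linkedC : symmetric linked.
Proof. by move=> p q; apply: eq_existsb => s; rewrite andbC. Qed.

(** A matching is encoded as an involution that is the identity outside [W]; its fixed points in [W]
    are the unmatched vertices, for which being linked to the image is trivial. *)
Definition matching (W : {set T}) (m : {ffun T -> T}) : bool :=
  [forall p, (m (m p) == p) &&
     (if p \in W then (m p \in W) && linked p (m p) else m p == p)].

Definition unmatched (W : {set T}) (m : {ffun T -> T}) : {set T} := [set p in W | m p == p].

(** The former partners of [p] and [q] become fixed points, so the result is again an involution. *)
Definition pairup p q (m : {ffun T -> T}) : {ffun T -> T} :=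
  [ffun z => if z == p then q else if z == q then p else
             if (z == m p) || (z == m q) then z else m z].

Section MatchingTheory.
Variables (W : {set T}) (m : {ffun T -> T}).
Hypothesis mM : matching W m.

Lemma matchingK : involutive m.
Proof. by move=> p; have /forallP/(_ p)/andP[/eqP] := mM. Qed.

Lemma matching_in p : p \in W -> m p \in W.
Proof. by move=> Wp; have /forallP/(_ p)/andP[_] := mM; rewrite Wp => /andP[]. Qed.

Lemma matching_linked p : p \in W -> linked p (m p).
Proof. by move=> Wp; have /forallP/(_ p)/andP[_] := mM; rewrite Wp => /andP[]. Qed.

Lemma pairup_matching p q :
  p \in W -> q \in W -> linked p q -> matching W (pairup p q m).
Proof.
move=> Wp Wq lpq; have mi := inv_inj matchingK.
apply/forallP=> z; rewrite !ffunE.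
have [-> | zp] := eqVneq z p.
  by rewrite eqxx Wp Wq lpq; case: (eqVneq q p) => [->|_]; rewrite eqxx.
have [-> | zq] := eqVneq z q; first by rewrite !eqxx Wp Wq linkedC lpq.
have [mz | mz] := boolP ((z == m p) || (z == m q)).
  rewrite (negPf zp) (negPf zq) mz eqxx; case: ifP => // Wz; rewrite Wz.
  by apply/existsP; exists z; rewrite cadjxx.
have /norP[zmp zmq] := mz.
have shift u : (m z == u) = (z == m u) by rewrite -(inj_eq mi) matchingK.
rewrite !shift !matchingK (negPf zp) (negPf zq) (negPf zmp) (negPf zmq) /= eqxx /=.
by have /forallP/(_ z)/andP[_] := mM; rewrite shift.
Qed.

Lemma unmatched_pairup p q : p \in W -> q \in W -> p != q ->
  unmatched W (pairup p q m) = (unmatched W m :|: [set m p; m q]) :\: [set p; q].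
Proof.
move=> Wp Wq pq; apply/setP=> z; rewrite !inE ffunE.
have [-> | zp] := eqVneq z p; first by rewrite eq_sym (negPf pq) andbF.
have [-> | zq] := eqVneq z q; first by rewrite (negPf pq) andbF.
have [/orP[]/eqP-> | _] := boolP ((z == m p) || (z == m q)).
- by rewrite eqxx matching_in // orbT.
- by rewrite eqxx matching_in // !orbT.
by rewrite !orbF.
Qed.

Lemma matching_dominates : exists2 S, dominates S W & 2 * #|S| <= #|W| + #|unmatched W m|.
Proof.
pose f p := odflt p (if m p == p then Some p else [pick s | cadj s p && cadj s (m p)]).
have fP p : p \in W -> cadj p (f p).
  move=> Wp; rewrite /f; case: eqP => _ /=; first exact: cadjxx.
  case: pickP => [s /andP[] | no] /=; first by rewrite cadjC.
  by have /existsP[s] := matching_linked Wp; rewrite no.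
(* The predicate given to [pick] is symmetric in the pair, so both ends choose the same dominating
   vertex. *)
have fm p : p \in W -> f (m p) = f p.
  move=> Wp; rewrite /f matchingK eq_sym; case: eqP => [/= ? | _]; first congruence.
  have -> : [pick s | cadj s (m p) && cadj s p] = [pick s | cadj s p && cadj s (m p)].
    by apply: eq_pick => s; rewrite andbC.
  case: pickP => //= no.
  by have /existsP[s] := matching_linked Wp; rewrite no.
exists (f @: W); first by move=> x Wx; exists (f x); [exact: imset_f | exact: fP].
set U := unmatched W m; pose M := W :\: U.
have UW : U \subset W by apply/subsetP=> p; rewrite inE => /andP[].
have cardW : #|W| = #|U| + #|M| by rewrite -(cardsID U W) (setIidPr UW).
have -> : f @: W = (f @: U) :|: (f @: M).
  by rewrite -imsetU -{1}(setID W U) (setIidPr UW).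
have := leq_imset_card f U; have := cardsUI (f @: U) (f @: M).
(* Every fibre of [f] over the matched vertices contains both ends of a pair, hence at least two
   vertices. *)
suff: 2 * #|f @: M| <= #|M| by lia.
rewrite -[leqRHS]sum1_card (partition_big_imset f) /= mulnC -sum_nat_const.
apply: leq_sum => s /imsetP[p Mp ->]; rewrite sum1dep_card.
have [Wp mp] : p \in W /\ m p != p by move: Mp; rewrite !inE; case: (p \in W); rewrite ?andbF ?andbT.
have <- : #|[set p; m p]| = 2 by rewrite cards2 eq_sym mp.
have Mmp : m p \in M by rewrite !inE matchingK eq_sym (negPf mp) matching_in.
apply/subset_leq_card/subsetP=> z; rewrite in_set2 => /orP[] /eqP->; rewrite [_ \in _]inE.
  by rewrite Mp eqxx.
by rewrite Mmp fm ?eqxx.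
Qed.

End MatchingTheory.

(* Minimising the number of unmatched vertices excludes augmenting paths; the second
   term of the measure prefers matching a vertex along an edge, so that no unmatched
   vertex keeps a neighbour in [W]. *)
Lemma optimal_matching (W : {set T}) :
  (forall x, x \in W -> wdeg W x <= 2) ->
  exists m, [/\ matching W m,
    forall p q, p \in unmatched W m -> q \in unmatched W m -> linked p q -> p = q,
    forall p x, p \in unmatched W m -> x \in W -> ~~ e p x &
    forall p q1 q2, p \in W -> m p != p -> q1 \in unmatched W m -> q2 \in unmatched W m ->
      linked p q1 -> linked (m p) q2 -> q1 = q2].
Proof.
move=> dW; pose bad m : {set T} := [set p in W | ~~ e p ((m : {ffun T -> T}) p)].
(* As [#|bad m|] is at most [#|T|], the factor [#|T|.+1] makes this a lexicographic comparison. *)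
pose mu m := #|T|.+1 * #|unmatched W m| + #|bad m|.
have id_matching : matching W [ffun p => p].
  apply/forallP=> p; rewrite !ffunE eqxx; case: ifP => //= ->.
  by apply/existsP; exists p; rewrite cadjxx.
case: (arg_minnP mu id_matching) => m mM mmin; exists m.
have fewer m' : matching W m' -> #|unmatched W m| <= #|unmatched W m'|.
  move=> /mmin; rewrite /mu; have bT : #|bad m'| <= #|T| by exact: max_card.
  move=> le_mu; rewrite leqNgt; apply/negP=> lt_U.
  have : #|T|.+1 * #|unmatched W m'|.+1 <= #|T|.+1 * #|unmatched W m|.
    by rewrite leq_mul2l lt_U orbT.
  by rewrite mulnS; lia.
have inU p : p \in unmatched W m -> p \in W /\ m p = p by rewrite inE => /andP[? /eqP].
have joined p q : p \in unmatched W m -> q \in unmatched W m -> linked p q -> p = q.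
  move=> Up Uq lpq; apply/eqP/negPn/negP => pq.
  have [[Wp mp] [Wq mq]] := (inU p Up, inU q Uq).
  have := fewer _ (pairup_matching mM Wp Wq lpq); rewrite unmatched_pairup // mp mq.
  have -> : (unmatched W m :|: [set p; q]) :\: [set p; q] = unmatched W m :\: [set p; q].
    by rewrite setDUl setDv setU0.
  rewrite leqNgt => /negP[]; apply: proper_card; apply/properP.
  by split; [exact: subsetDl | exists p; rewrite // !inE eqxx].
split=> // [p x Up Wx | p q1 q2 Wp mp Uq1 Uq2 l1 l2].
  apply/negP => epx; have [Wp mp] := inU p Up.
  have lpx : linked p x by apply/existsP; exists p; rewrite cadjxx /cadj epx orbT.
  have px : p != x by apply/eqP=> px; rewrite px e_irr in epx.
  have mx : m x != x.
    apply/eqP=> mx; have Ux : x \in unmatched W m by rewrite inE Wx mx eqxx.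
    by rewrite (joined p x Up Ux lpx) eqxx in px.
  have mxp : m x != p by apply: contra px => /eqP mxp; rewrite -mp -mxp (matchingK mM).
  (* Pairing [p] with [x] frees [m x] instead of [p], so the number of unmatched vertices is
     unchanged. By the bound on [wdeg], [p] is the only neighbour of [x] in [W], so [m x] was bad
     already, while [p] stops being bad. *)
  have m'M := pairup_matching mM Wp Wx lpx.
  have Ucard : #|unmatched W (pairup p x m)| = #|unmatched W m|.
    rewrite unmatched_pairup // mp.
    have -> : (unmatched W m :|: [set p; m x]) :\: [set p; x] = m x |: (unmatched W m :\ p).
      apply/setP=> z; rewrite !inE.
      have [-> | zp] := eqVneq z p; first by rewrite [p == m x]eq_sym (negPf mxp).
      have [-> | zx] := eqVneq z x; first by rewrite [x == m x]eq_sym (negPf mx) andbF.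
      by rewrite orbC.
    rewrite cardsU1 !inE mxp matching_in //= (matchingK mM) eq_sym mx /=.
    by rewrite (cardsD1 p (unmatched W m)) Up.
  have nbx : wnb W x = [set x; p].
    apply/esym/eqP; rewrite eqEcard cards2 eq_sym px (leq_trans (dW x Wx)) // andbT.
    apply/subsetP=> z; rewrite !inE => /orP[] /eqP->; rewrite ?cadjxx ?Wx ?Wp //.
    by rewrite /cadj e_sym epx orbT.
  have := mmin _ m'M; rewrite /mu Ucard leq_add2l leqNgt => /negP[].
  apply: proper_card; apply/properP; split; last first.
    by exists p; rewrite !inE ?Wp ?mp ?e_irr // ffunE eqxx epx.
  apply/subsetP=> z; rewrite !inE ffunE => /andP[Wz].
  rewrite Wz /=; have [-> | zp] := eqVneq z p; first by rewrite mp e_irr.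
  have [-> | zx] := eqVneq z x; first by rewrite e_sym epx.
  case: ifP => // /orP[]/eqP zE _; first by rewrite zE mp eqxx in zp.
  rewrite zE (matchingK mM); apply/negP => emx.
  have : m x \in wnb W x by rewrite in_wnb /cadj e_sym emx orbT matching_in.
  by rewrite nbx !inE (negPf mx) (negPf mxp).
apply/eqP/negPn/negP => q12.
have [[Wq1 mq1] [Wq2 mq2]] := (inU _ Uq1, inU _ Uq2).
have neq z q : q \in unmatched W m -> m z != z -> q != z.
  by move=> /inU[_ mq] mz; apply: contra mz => /eqP <-; rewrite mq.
have mmp : m (m p) != m p by rewrite (matchingK mM) eq_sym.
(* The augmenting path [q1], [p], [m p], [q2] is flipped by two re-pairings, after which neither
   [q1] nor [q2] is unmatched. *)
have m1M := pairup_matching mM Wp Wq1 l1.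
have Wmp := matching_in mM Wp.
have m1mp : pairup p q1 m (m p) = m p.
  by rewrite ffunE (negPf mp) eq_sym (negPf (neq _ _ Uq1 mmp)) eqxx.
have m1q2 : pairup p q1 m q2 = q2.
  by rewrite ffunE (negPf (neq _ _ Uq2 mp)) eq_sym (negPf q12) mq2; case: ifP.
have := fewer _ (pairup_matching m1M Wmp Wq2 l2).
rewrite unmatched_pairup ?m1mp ?m1q2 // 1?eq_sym ?(neq _ _ Uq2) //.
rewrite unmatched_pairup // 1?eq_sym ?(neq _ _ Uq1) // mq1 leqNgt => /negP[].
apply: proper_card; apply/properP; split; last first.
  by exists q1; rewrite // !inE eqxx (negPf q12) (negPf (neq _ _ Uq1 mmp)) !orbT.
apply/subsetP=> z; rewrite !inE.
case: (eqVneq z (m p)) => //=; case: (eqVneq z q2) => //=; case: (eqVneq z q1) => //=.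
  by move=> -> _ _; rewrite orbT.
by move=> _ _ _; rewrite !orbF => /andP[].
Qed.

Definition covered N (W : {set T}) c := exists2 S, dominates S W & N * #|S| <= c.

Lemma card_blue (W : {set T}) p : #|cnbhd p :\: W| = d.+1 - wdeg W p.
Proof. by rewrite -(card_cnbhd p) -(cardsID W (cnbhd p)) addKn. Qed.

Lemma leq_mul_mix k n t x y : x <= y -> k <= n -> t <= n -> k * x <= t * x + (n - t) * y.
Proof. by move=> xy kn tn; nia. Qed.

(** Worst case for two matched partners: each has at least [k.-1] blue neighbours, and at most [k]
    of all these pay the smaller share [x], so at least [k - 2] pay [y]. *)
Lemma leq_mul_mix2 k n1 n2 t1 t2 x y : x <= y -> 1 < k -> k.-1 <= n1 -> k.-1 <= n2 ->
  t1 <= n1 -> t2 <= n2 -> t1 + t2 <= k ->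
  k * x + (k - 2) * y <= t1 * x + (n1 - t1) * y + (t2 * x + (n2 - t2) * y).
Proof.
move=> xy k1 kn1 kn2 tn1 tn2 tk.
have -> : k * x = (t1 + t2) * x + (k - (t1 + t2)) * x by rewrite -mulnDl subnKC.
have : (k - (t1 + t2)) * x <= (k - (t1 + t2)) * y by rewrite leq_mul2l xy orbT.
have : (k - 2 + (k - (t1 + t2))) * y <= (n1 - t1 + (n2 - t2)) * y.
  by rewrite leq_mul2r; apply/orP; right; lia.
by rewrite !mulnDl; lia.
Qed.

(* Discharging: a blue vertex gives [b 1] to an unmatched neighbour and the rest to its
   other neighbour in [W], or splits evenly if both neighbours are matched.
   All quantities are doubled to avoid halves. *)
Lemma matching_covered N (W : {set T}) :
  b 2 <= 2 * b 1 -> 1 < d -> N <= w + d * b 1 ->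
  2 * N <= 4 * w + d.-1 * b 2 + d.-1 * (2 * (b 2 - b 1)) ->
  2 * N <= 4 * w + d * (2 * (b 2 - b 1)) + (d - 2) * b 2 ->
  (forall x, wdeg W x <= 2) -> covered N W (weight W).
Proof.
move=> b21 d1 HU Hpair Htri dW; set D2 := 2 * (b 2 - b 1) in Hpair Htri.
have b12 : b 1 <= b 2 by exact: bmono.
have D2b : D2 <= b 2 by rewrite /D2; lia.
have [m [mM Uind Unb Uaug]] := optimal_matching (fun x _ => dW x).
have [S SW cardS] := matching_dominates mM; exists S => //.
set U := unmatched W m in Uind Unb Uaug cardS.
have UW p : p \in U -> p \in W by rewrite inE => /andP[].
pose hasU y := [exists u in U, cadj y u].
pose sh p y := if p \in U then 2 * b 1 else if hasU y then D2 else b 2.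
have sh_le y : y \in ~: W -> \sum_(p in W | cadj p y) sh p y <= 2 * b (wdeg W y).
  move=> yW; rewrite (eq_bigl (mem (wnb W y))); last first.
    by move=> p; rewrite /= in_wnb cadjC andbC.
  have inWy p : p \in wnb W y -> cadj y p by rewrite in_wnb => /andP[].
  have linkWy p q : p \in wnb W y -> q \in wnb W y -> linked p q.
    by move=> /inWy yp /inWy yq; apply/existsP; exists y; rewrite yp.
  have shU p q : p \in wnb W y -> q \in wnb W y -> p != q -> p \in U -> sh p y + sh q y <= 2 * b 2.
    move=> yp yq pq Up; have Uq : q \notin U.
      apply: contra pq => Uq; apply/eqP/Uind => //; exact: linkWy.
    have hU : hasU y by apply/existsP; exists p; rewrite Up inWy.
    by rewrite /sh Up (negPf Uq) hU /D2; lia.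
  have := dW y; rewrite /wdeg; case def_n: #|wnb W y| => [|[|[|n]]] // _.
  - by move/eqP: def_n; rewrite cards_eq0 => /eqP->; rewrite big_set0.
  (* Each of the three possible shares is at most [2 * b 1], because [b 2 <= 2 * b 1]. *)
  - have /cards1P[p ->] : #|wnb W y| == 1 by rewrite def_n.
    by rewrite big_set1 /sh; case: ifP => _; [|case: ifP => _]; lia.
  have /cards2P[p [q [pq Wy]]] : #|wnb W y| == 2 by rewrite def_n.
  have [yp yq] : p \in wnb W y /\ q \in wnb W y by rewrite Wy !inE !eqxx orbT.
  rewrite Wy big_setU1 ?inE //= big_set1.
  have [Up | nUp] := boolP (p \in U); first exact: shU.
  have [Uq | nUq] := boolP (q \in U); first by rewrite addnC; apply: shU; rewrite // eq_sym.
  by rewrite /sh (negPf nUp) (negPf nUq); case: ifP => _; lia.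
pose ch p := 2 * w + \sum_(y in ~: W | cadj p y) sh p y.
have weight_ge : \sum_(p in W) ch p <= 2 * weight W.
  rewrite big_split /= sum_nat_const /weight mulnDr big_distrr /=.
  have -> : 2 * (w * #|W|) = #|W| * (2 * w) by lia.
  rewrite leq_add2l; apply: leq_trans (leq_sum _ sh_le).
  rewrite (exchange_big_dep (fun y => y \in ~: W)) /=; last by move=> p y _ /andP[].
  by apply/eq_leq/eq_bigr => y yW; apply: eq_bigl => p; rewrite yW.
have blue_sum p c : \sum_(y in ~: W | cadj p y) c = #|cnbhd p :\: W| * c.
  by rewrite -sum_nat_const; apply: eq_bigl => y; rewrite !inE.
have chU p : p \in U -> 2 * N <= ch p.
  move=> Up; rewrite /ch (eq_bigr (fun=> 2 * b 1)); last by move=> y _; rewrite /sh Up.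
  rewrite blue_sum card_blue.
  (* An unmatched vertex has no neighbour in [W], so it collects [2 * b 1] from all [d]
     neighbours. *)
  have -> : wdeg W p = 1.
    apply/eqP/cards1P; exists p; apply/setP=> z; rewrite in_wnb in_set1 /cadj eq_sym.
    have [-> | zp] := eqVneq z p; first by rewrite UW.
    by apply/negP=> /andP[/= epz /(Unb p z Up)]; rewrite epz.
  by rewrite subn1 /=; lia.
pose Tb p : {set T} := [set y in cnbhd p :\: W | hasU y].
have chM p : p \notin U -> ch p = 2 * w + #|Tb p| * D2 + (#|cnbhd p :\: W| - #|Tb p|) * b 2.
  move=> nUp; rewrite /ch -addnA; congr (_ + _).
  rewrite (bigID hasU) /=; congr (_ + _).
    rewrite (eq_bigr (fun=> D2)); last by move=> y /andP[_ hU]; rewrite /sh (negPf nUp) hU.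
    by rewrite -sum_nat_const; apply: eq_bigl => y; rewrite !inE.
  rewrite (eq_bigr (fun=> b 2)); last first.
    by move=> y /andP[_ hU]; rewrite /sh (negPf nUp) (negPf hU).
  rewrite -(cardsID [set y | hasU y] (cnbhd p :\: W)).
  have -> : Tb p = (cnbhd p :\: W) :&: [set y | hasU y] by apply/setP=> y; rewrite !inE.
  by rewrite addKn -sum_nat_const; apply: eq_bigl => y; rewrite !inE andbC.
have blue_ge p : d.-1 <= #|cnbhd p :\: W| by rewrite card_blue; have := dW p; lia.
have Tb_le p : #|Tb p| <= #|cnbhd p :\: W|.
  by apply/subset_leq_card/subsetP=> y; rewrite inE => /andP[].
have TbP p y : p \in W -> y \in Tb p -> exists2 q, q \in U & cadj y q /\ linked p q.
  move=> Wp; rewrite !inE => /andP[/andP[_ py] /existsP[q /andP[Uq yq]]].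
  by exists q => //; split=> //; apply/existsP; exists y; rewrite cadjC py.
have no_aug p : p \in W -> p \notin U -> 2 * N <= ch p + ch (m p).
  move=> Wp nUp; have mp : m p != p by move: nUp; rewrite !inE Wp.
  have Wx := matching_in mM Wp; set x := m p in mp Wx *.
  have nUx : x \notin U by rewrite !inE Wx /x (matchingK mM) eq_sym.
  rewrite (chM p nUp) (chM x nUx).
  have := (blue_ge p, blue_ge x, Tb_le p, Tb_le x).
  set np := #|_ p :\: _|; set nx := #|_ x :\: _|; set tp := #|Tb p|; set tx := #|Tb x|.
  case=> [[[gep gex] lep] lex].
  have split4 : 2 * w + tp * D2 + (np - tp) * b 2 + (2 * w + tx * D2 + (nx - tx) * b 2) =
      4 * w + ((tp * D2 + (np - tp) * b 2) + (tx * D2 + (nx - tx) * b 2)).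
    by clear; lia.
  rewrite split4.
  (* A partner with no blue neighbour next to an unmatched vertex collects [b 2] from each blue
     neighbour; the other one collects at least [D2] from each. *)
  have [tp0 | tp0] := posnP tp.
    apply: leq_trans Hpair _; rewrite -addnA leq_add2l tp0 subn0 mul0n add0n.
    by rewrite leq_add ?leq_mul2r ?gep ?orbT // leq_mul_mix.
  have [tx0 | tx0] := posnP tx.
    apply: leq_trans Hpair _; rewrite -addnA leq_add2l tx0 subn0 mul0n add0n addnC.
    by rewrite leq_add ?leq_mul2r ?gex ?orbT // leq_mul_mix.
  (* In the absence of augmenting paths, all unmatched vertices linked to [p] or to [x] are one and
     the same vertex [q], so the cheap blue neighbours of both partners are blue neighbours of
     [q]. *)
  have /card_gt0P[y0 /(TbP _ _ Wp)[q Uq [_ lpq]]] := tp0.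
  have /card_gt0P[y1 /(TbP _ _ Wx)[q' Uq' [_ lxq']]] := tx0.
  have qq' : q = q' by exact: Uaug lpq lxq'.
  have Tp : Tb p \subset cnbhd q :\: W.
    apply/subsetP=> y Ty; have [u Uu [yu lpu]] := TbP _ _ Wp Ty.
    move: Ty; rewrite qq' -(Uaug _ _ _ Wp mp Uu Uq' lpu lxq').
    by rewrite !inE [cadj u y]cadjC yu => /andP[/andP[->]].
  have Tx : Tb x \subset cnbhd q :\: W.
    apply/subsetP=> y Ty; have [u Uu [yu lxu]] := TbP _ _ Wx Ty.
    move: Ty; rewrite (Uaug _ _ _ Wp mp Uq Uu lpq lxu).
    by rewrite !inE [cadj u y]cadjC yu => /andP[/andP[->]].
  (* A common element would have the three white neighbours [p], [x] and [q]. *)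
  have disj : [disjoint Tb p & Tb x].
    apply/pred0P=> y /=; apply/negP=> /andP[yp yx].
    have /setDP[yq _] := subsetP Tp y yp.
    move: yp yx yq; rewrite !inE => /andP[/andP[_ py] _] /andP[/andP[_ xy] _] qy.
    have qp : q != p by apply: contra nUp => /eqP <-.
    have qx : q != x by apply: contra nUx => /eqP <-.
    have : size [:: p; x; q] <= wdeg W y.
      apply: uniq_leq_card => [|z]; first by rewrite /= !inE negb_or !(eq_sym p) mp qp eq_sym qx.
      rewrite !inE => /or3P[] /eqP->; rewrite cadjC ?py ?xy ?qy ?Wp ?Wx //=; exact: UW.
    by rewrite leqNgt ltnS dW.
  have T_le : tp + tx <= d.
    have nq : #|cnbhd q :\: W| <= d.
      rewrite card_blue leq_subLR -add1n leq_add2r.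
      by apply/card_gt0P; exists q; rewrite in_wnb cadjxx UW.
    apply: leq_trans nq; have [_] := leq_card_setU (Tb p) (Tb x).
    by rewrite disj => /eqP <-; rewrite subset_leq_card // subUset Tp Tx.
  by apply: leq_trans Htri _; rewrite -addnA leq_add2l leq_mul_mix2.
pose M := W :\: U.
have sumM : N * #|M| <= \sum_(p in M) ch p.
  (* Summing the bound for pairs over all of [M] counts each pair twice; the involution [m]
     reindexes one half of the sum. *)
  have sub : \sum_(p in M) ch (m p) = \sum_(p in M) ch p.
    rewrite [RHS](reindex_inj (inv_inj (matchingK mM))); apply: eq_bigl => p.
    rewrite !inE (matchingK mM) [p == _]eq_sym.
    have [Wp | nWp] := boolP (p \in W); first by rewrite matching_in.
    by rewrite andbF; apply/esym/negP=> /andP[_ /(matching_in mM)]; rewrite (matchingK mM) (negPf nWp).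
  have : \sum_(p in M) 2 * N <= \sum_(p in M) (ch p + ch (m p)).
    by apply: leq_sum => p /setDP[Wp nUp]; exact: no_aug.
  by rewrite sum_nat_const big_split /= sub; lia.
have sumU : 2 * N * #|U| <= \sum_(p in U) ch p.
  by rewrite mulnC -sum_nat_const; apply: leq_sum.
have UsW : U \subset W by apply/subsetP.
have sumW : \sum_(p in W) ch p = \sum_(p in U) ch p + \sum_(p in M) ch p.
  by rewrite (big_setID U) /= (setIidPr UsW).
have cardW : #|W| = #|U| + #|M| by rewrite -(cardsID U W) (setIidPr UsW).
have : N * (2 * #|S|) <= N * (#|W| + #|U|) by rewrite leq_mul2l cardS orbT.
by rewrite cardW !mulnDr; lia.
Qed.

(** * Reductions when closed neighbourhoods contain at most three undominated vertices *)

Lemma wdeg_le_size (W : {set T}) x (s : seq T) :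
  {subset wnb W x <= s} -> wdeg W x <= size s.
Proof.
by move=> sub; apply: leq_trans (card_size s); apply/subset_leq_card/subsetP.
Qed.

Lemma wdeg_self (W : {set T}) v : wdeg (W :\: cnbhd v) v = 0.
Proof. by apply/eqP; rewrite cards_eq0; apply/eqP/setP=> y; rewrite !inE; case: cadj. Qed.

Lemma wdeg_red (W : {set T}) v y :
  {subset wnb W y <= cnbhd v} -> wdeg (W :\: cnbhd v) y = 0.
Proof.
move=> sub; apply/eqP; rewrite cards_eq0; apply/eqP/setP=> x; rewrite !inE.
apply/negP=> /and3P[yx vx Wx]; case/negP: vx.
by have := sub x; rewrite in_wnb yx Wx inE => /(_ isT).
Qed.

Lemma wdeg_drop (W : {set T}) v x s i : uniq s ->
  all (fun y => [&& y \in W, cadj v y & cadj x y]) s ->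
  wdeg W x <= i + size s -> wdeg (W :\: cnbhd v) x <= i.
Proof.
move=> us /allP hs; rewrite (wdeg_split W v x) => le_i.
have : size s <= #|wnb W v :&: cnbhd x|.
  by apply: uniq_leq_card => // y /hs; rewrite !inE => /and3P[-> -> ->].
by move: le_i; clear; lia.
Qed.

Definition shrink (W : {set T}) (s : seq T) := foldl (fun V v => V :\: cnbhd v) W s.

Lemma shrink_sub W s : shrink W s \subset W.
Proof.
elim: s W => //= v s IHs W; apply: subset_trans (IHs _) _; exact: subsetDl.
Qed.

Variables (N dl E : nat).

(** The proper inclusion makes the induction on [#|W|] progress. *)
Definition reducible (W : {set T}) := exists2 s,
  shrink W s \proper W & weight (shrink W s) + N * size s <= weight W.

Lemma reducibleI (W : {set T}) v x s : x \in wnb W v ->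
  weight (shrink (W :\: cnbhd v) s) + N * (size s).+1 <= weight W -> reducible W.
Proof.
rewrite in_wnb => /andP[vx Wx] le_w; exists (v :: s) => //=.
apply: sub_proper_trans (shrink_sub _ _) _; apply/properP; split; first exact: subsetDl.
by exists x; rewrite // !inE vx.
Qed.

Definition low (W : {set T}) := forall y, wdeg W y <= 3.

Lemma lowS (W1 W2 : {set T}) : W1 \subset W2 -> low W2 -> low W1.
Proof. by move=> sW lW y; apply: leq_trans (lW y); exact: wdegS. Qed.

(* A lower bound for the gain at a vertex whose [wdeg] drops from at most [i] to at most [j]. *)
Definition G i j := w + dl * (d.+1 - i) - b j.

Hypotheses (slope3 : has_slope dl 3) (E_le : forall i, 0 < i <= 3 -> E + dl * i <= b i).

(** Form of [weight_drop] used for small white degrees. An entry of [s] carries bounds on [wdeg]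
    before and after the step; a vertex of [t] is blue and loses all its white neighbours, one to
    three in number, so [E_le] bounds its [extra] by [E]. *)
Lemma low_drop (W : {set T}) v (s : seq (T * (nat * nat))) (t : seq T) : low W ->
  uniq (map fst s) ->
  all (fun p => [&& p.1 \in wnb W v, wdeg W p.1 <= p.2.1 &
                    wdeg (W :\: cnbhd v) p.1 <= p.2.2]) s ->
  uniq t ->
  all (fun y => [&& y \notin W, 0 < wdeg W y & wdeg (W :\: cnbhd v) y == 0]) t ->
  weight (W :\: cnbhd v) + \sum_(p <- s) G p.2.1 p.2.2 + E * size t <= weight W.
Proof.
move=> lW us /allP hs ut /allP ht.
have sA : {subset map fst s <= wnb W v} by move=> x /mapP[p /hs /and3P[? _ _] ->].
have tW : {subset t <= ~: W} by move=> y /ht /and3P[? _ _]; rewrite inE.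
apply: leq_trans (weight_drop slope3 (fun y _ => lW y) us sA ut tW).
rewrite -2!(addnA (weight _)) leq_add2l big_map; apply: leq_add.
  by apply: leq_sum_in => p /hs /and3P[_ le1 le2]; exact: gain_ge.
rewrite mulnC -sum1_size big_distrl /=; apply: leq_sum_in => y.
rewrite mul1n => /ht /and3P[_ gt0 /eqP eq0]; rewrite /extra eq0 b0 subn0.
have := wdeg_split W v y; rewrite eq0 add0n => <-.
have rng : 0 < wdeg W y <= 3 by rewrite gt0 lW.
by have := E_le rng; clear; lia.
Qed.

(** * Paths, triangles and cycles of length at least five *)

Lemma wnb_seq3 (W : {set T}) v x : v \in W -> wdeg W v = 3 -> x \in wnb W v -> x != v ->
  exists2 y, uniq [:: v; x; y] & wnb W v =i [:: v; x; y].
Proof.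
move=> Wv dv vx xv; have vv : v \in wnb W v by rewrite in_wnb cadjxx.
have [|y vy ny] := @exists_notin (wnb W v) [:: v; x]; first by rewrite [#|_|]dv.
have us : uniq [:: v; x; y].
  by move: ny; rewrite /= !inE !negb_or (eq_sym v x) xv (eq_sym v y) (eq_sym x y) => /andP[-> ->].
exists y => //; apply: uniq_eq_card => //; last by rewrite [#|_|]dv.
by move=> z; rewrite !inE => /or3P[]/eqP->; rewrite -in_wnb.
Qed.

(** Here [x] is the end of a path and [v] the vertex next to it: once [v] is picked, [x] has no
    white neighbour left and the other neighbour of [v] has at most one. *)
Lemma path_step (W : {set T}) v x : low W -> v \in W -> wdeg W v = 3 ->
  x \in wnb W v -> x != v -> wdeg W x <= 2 ->
  weight (W :\: cnbhd v) + (G 3 0 + G 2 0 + G 3 1) <= weight W.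
Proof.
move=> lW Wv dv vx xv dx; have [y us nv] := wnb_seq3 Wv dv vx xv.
have vy : y \in wnb W v by rewrite nv !inE eqxx !orbT.
have vv : v \in wnb W v by rewrite in_wnb cadjxx.
have adj z : z \in wnb W v -> [&& z \in W, cadj v z & cadj z v].
  by rewrite in_wnb => /andP[vz ->]; rewrite vz cadjC vz.
have dz z i : z \in wnb W v -> z != v -> wdeg W z <= i.+2 -> wdeg (W :\: cnbhd v) z <= i.
  move=> vz zv dWz; apply: (@wdeg_drop W v z [:: v; z]); rewrite ?addn2 //=.
    by rewrite inE eq_sym zv.
  by have /and3P[-> -> ->] := adj z vz; rewrite Wv !cadjxx.
have yv : y != v by move: us; rewrite /= !inE negb_or eq_sym (eq_sym v y) => /andP[/andP[_ ->]].
have := @low_drop W v [:: (v, (3, 0)); (x, (2, 0)); (y, (3, 1))] [::] lW us.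
rewrite /= vv vx vy dv dx (lW y) wdeg_self (dz x 0) ?(dz y 1) ?lW // => /(_ isT isT isT).
by rewrite !big_cons big_nil muln0 !addn0 !addnA.
Qed.

Hypotheses (n_path : N <= G 3 0 + G 2 0 + G 3 1) (n_tri : N <= 3 * G 3 0)
  (n_pentagon : 2 * N <= G 3 0 + 2 * G 3 1 + 2 * G 2 0 + 2 * E)
  (n_cycle : 2 * N <= G 3 0 + 2 * G 3 1 + (G 3 0 + G 2 0 + G 3 1)).

(* The component of [a] in the graph induced by [W] is the 4-cycle [a p c q]. *)
Definition square (W : {set T}) a p c q :=
  [/\ uniq [:: a; p; c; q], wnb W a =i [:: a; p; q], wnb W p =i [:: p; a; c],
      wnb W c =i [:: c; p; q] & wnb W q =i [:: q; a; c]].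

Lemma in_shrink (W : {set T}) v x : (x \in W :\: cnbhd v) = ~~ cadj v x && (x \in W).
Proof. by rewrite !inE. Qed.

(** The white component is explored from [v] in both directions, to [x1], [y1] and to [x2], [y2]. A
    path end met on the way is handled by [path_step], a triangle by [v] alone; otherwise the
    component closes up as a 4-cycle or a pentagon, or [y1] has a further neighbour [r]. *)
Lemma deg3_square (W : {set T}) v : low W -> v \in W -> wdeg W v = 3 ->
  reducible W \/ exists p c q, square W v p c q.
Proof.
move=> lW Wv dv.
have inW x y : y \in wnb W x -> y \in W by rewrite in_wnb => /andP[].
have self x : x \in W -> x \in wnb W x by rewrite in_wnb cadjxx.
have red_path u x : u \in W -> wdeg W u = 3 -> x \in wnb W u -> x != u -> wdeg W x <= 2 ->
    reducible W.
  move=> Wu du ux xu dx; apply: (@reducibleI W u u [::]); first exact: self.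
  by have := path_step lW Wu du ux xu dx; have := n_path; rewrite muln1 /=; clear; lia.
have deg3 x : ~~ (wdeg W x <= 2) -> wdeg W x = 3.
  by move=> nle; have := lW x; move: nle; clear; lia.
have [|x1 vx1 x1v] := @exists_notin (wnb W v) [:: v]; first by rewrite [#|_|]dv.
rewrite inE in x1v; have [x2 uv nv] := wnb_seq3 Wv dv vx1 x1v.
have vx2 : x2 \in wnb W v by rewrite nv !inE eqxx !orbT.
have [Wx1 Wx2] := (inW _ _ vx1, inW _ _ vx2).
have [x2v x12] : x2 != v /\ x1 != x2.
  by move: uv; rewrite /= !inE negb_or (eq_sym x2) => /and3P[/andP[_ ->] ->].
have [d1|/deg3 d1] := boolP (wdeg W x1 <= 2); first by left; apply: (red_path v x1).
have [d2|/deg3 d2] := boolP (wdeg W x2 <= 2); first by left; apply: (red_path v x2).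
have x1v' := wnb_sym Wv vx1; have x2v' := wnb_sym Wv vx2.
have adj x y : y \in wnb W x -> cadj x y by rewrite in_wnb => /andP[].
have dx x i : x \in wnb W v -> x != v -> wdeg W x <= i.+2 -> wdeg (W :\: cnbhd v) x <= i.
  move=> vx xv dWx; apply: (@wdeg_drop W v x [:: v; x]); rewrite ?addn2 //=.
    by rewrite inE eq_sym xv.
  by rewrite !cadjxx Wv (inW _ _ vx) (adj _ _ vx) cadjC (adj _ _ vx).
have [c12 | nc12] := boolP (cadj x1 x2).
  left; apply: (@reducibleI W v v [::]); first exact: self.
  have dr x : x \in [:: x1; x2] -> wdeg (W :\: cnbhd v) x <= 0.
    rewrite !inE => /orP[]/eqP->; apply: (@wdeg_drop W v _ [:: v; x1; x2] 0 uv); rewrite ?lW //=.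
      by rewrite !cadjxx Wv Wx1 Wx2 (adj _ _ vx1) (adj _ _ vx2) c12 (adj _ _ x1v').
    by rewrite !cadjxx Wv Wx1 Wx2 (adj _ _ vx1) (adj _ _ vx2) (cadjC x2 x1) c12 (adj _ _ x2v').
  have := @low_drop W v [:: (v, (3, 0)); (x1, (3, 0)); (x2, (3, 0))] [::] lW uv.
  rewrite /= self // vx1 vx2 !lW wdeg_self !dr ?inE ?eqxx ?orbT // => /(_ isT isT isT).
  by rewrite !big_cons big_nil /=; have := n_tri; clear; lia.
have [vx1n vx2n] : v != x1 /\ v != x2 by rewrite !(eq_sym v).
have [y1 u1 n1] := wnb_seq3 Wx1 d1 x1v' vx1n.
have [y2 u2 n2] := wnb_seq3 Wx2 d2 x2v' vx2n.
have xy1 : y1 \in wnb W x1 by rewrite n1 !inE eqxx !orbT.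
have xy2 : y2 \in wnb W x2 by rewrite n2 !inE eqxx !orbT.
have [Wy1 Wy2] := (inW _ _ xy1, inW _ _ xy2).
have [y1x1 y1v] : y1 != x1 /\ y1 != v.
  by move: u1; rewrite /= !inE negb_or !(eq_sym y1) => /and3P[/andP[_ ->] ->].
have [y2x2 y2v] : y2 != x2 /\ y2 != v.
  by move: u2; rewrite /= !inE negb_or !(eq_sym y2) => /and3P[/andP[_ ->] ->].
have y1x2 : y1 != x2 by apply: contra nc12 => /eqP <-; exact: adj.
have y2x1 : y2 != x1 by apply: contra nc12 => /eqP <-; rewrite cadjC; exact: adj.
have [e1|/deg3 e1] := boolP (wdeg W y1 <= 2); first by left; apply: (red_path x1 y1).
have y1x1' := wnb_sym Wx1 xy1; have y2x2' := wnb_sym Wx2 xy2.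
have x1y1 : x1 != y1 by rewrite eq_sym.
have [r ur nr] := wnb_seq3 Wy1 e1 y1x1' x1y1.
have [y12 | y12] := eqVneq y1 y2.
  right; exists x1, y1, x2; split=> //; last by rewrite y12.
    rewrite /= !inE !negb_or (eq_sym v x1) x1v (eq_sym v y1) y1v (eq_sym v x2) x2v.
    by rewrite x1y1 x12 y1x2.
  suff rx2 : r = x2 by rewrite -rx2.
  have : x2 \in wnb W y1 by rewrite y12.
  by rewrite nr !inE eq_sym (negPf y1x2) (eq_sym x2) (negPf x12) => /eqP.
left; set W1 := W :\: cnbhd v; have sW1 : W1 \subset W by exact: subsetDl.
have lW1 : low W1 by exact: lowS lW.
have stepv : weight W1 + (G 3 0 + 2 * G 3 1) <= weight W.
  have := @low_drop W v [:: (v, (3, 0)); (x1, (3, 1)); (x2, (3, 1))] [::] lW uv.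
  rewrite /= self // vx1 vx2 !lW wdeg_self !dx ?lW // => /(_ isT isT isT).
  by rewrite !big_cons big_nil /= -/W1; clear; lia.
have inW1 x : x \in W -> x \notin [:: v; x1; x2] -> x \in W1.
  by move=> Wx; rewrite -nv in_wnb Wx andbT in_shrink => ->.
have W1y1 : y1 \in W1 by rewrite inW1 // !inE !negb_or y1v y1x1 y1x2.
have W1y2 : y2 \in W1 by rewrite inW1 // !inE !negb_or y2v y2x1 y2x2.
have dy1 : wdeg W1 y1 <= 2.
  apply: (@wdeg_drop W v y1 [:: x1]); rewrite ?e1 //=.
  by rewrite Wx1 (adj _ _ vx1) (adj _ _ y1x1').
(* In a pentagon, [v] and [y1] are picked. The second step takes away the last white neighbours of
   [x1] and [x2], each of which yields [E]. *)
have [c12' | nc12'] := boolP (cadj y1 y2).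
  have dy2 : wdeg W1 y2 <= 2.
    apply: (@wdeg_drop W v y2 [:: x2]); rewrite ?lW //=.
    by rewrite Wx2 (adj _ _ vx2) (adj _ _ y2x2').
  apply: (@reducibleI W v v [:: y1]); rewrite ?self // -/W1 /=.
  have hit x y : x \in wnb W v -> wnb W x =i [:: x; v; y] -> y \in W1 -> cadj y1 y ->
      [&& x \notin W1, 0 < wdeg W1 x & wdeg (W1 :\: cnbhd y1) x == 0].
    move=> vx nx W1y cy; rewrite in_shrink (adj _ _ vx) /=; apply/andP; split.
      by apply/card_gt0P; exists y; rewrite in_wnb W1y andbT adj // nx !inE eqxx !orbT.
    apply/eqP/wdeg_red => z; rewrite in_wnb => /andP[xz].
    rewrite in_shrink => /andP[vz Wz].
    have : z \in wnb W x by rewrite in_wnb xz.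
    rewrite nx !inE => /or3P[] /eqP zE; rewrite zE ?cadjxx ?(adj _ _ vx) // in vz *.
  have := @low_drop W1 y1 [:: (y1, (2, 0)); (y2, (2, 0))] [:: x1; x2] lW1.
  rewrite /= !mem_seq1 y12 x12 !in_wnb cadjxx W1y1 W1y2 c12' dy1 dy2 wdeg_self.
  rewrite (@wdeg_drop W1 y1 y2 [:: y1; y2] 0) /=; last first.
  - exact: dy2.
  - by rewrite !cadjxx W1y1 W1y2 c12' cadjC c12'.
  - by rewrite inE y12.
  have h1 := hit _ _ vx1 n1 W1y1 (cadjxx y1); have h2 := hit _ _ vx2 n2 W1y2 c12'.
  rewrite h1 h2 => /(_ isT isT isT isT).
  by rewrite !big_cons big_nil /=; move: stepv n_pentagon; clear; lia.
have y1r : r \in wnb W y1 by rewrite nr !inE eqxx !orbT.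
have [ry1 rx1] : r != y1 /\ r != x1.
  by move: ur; rewrite /= !inE negb_or !(eq_sym r) => /and3P[/andP[_ ->] ->].
have Wr := inW _ _ y1r.
have ry2 : r != y2 by apply: contra nc12' => /eqP <-; exact: adj.
have rv : r != v.
  apply/eqP=> rv; have := wnb_sym Wy1 y1r.
  by rewrite rv nv !inE (negPf y1v) (negPf y1x1) (negPf y1x2).
have rx2 : r != x2.
  apply/eqP=> rx2; have := wnb_sym Wy1 y1r.
  by rewrite rx2 n2 !inE (negPf y1v) (negPf y12) (negPf y1x2).
have [dr|/deg3 dr] := boolP (wdeg W r <= 2); first exact: (red_path y1 r).
have W1r : r \in W1 by rewrite inW1 // !inE !negb_or rv rx1 rx2.
(* Once [v] is picked, [y1] is the end of a path, and [r] next to it has lost nothing, so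
   [path_step] applies to [r] in [W1]. *)
have dr1 : wdeg W1 r = 3.
  have := wdeg_split W v r; rewrite dr -/W1; suff -> : wnb W v :&: cnbhd r = set0.
    by rewrite cards0 addn0.
  apply/setP=> z; rewrite in_setI nv in_set0; apply/negP=> /andP[].
  rewrite !inE => /or3P[]/eqP-> rz.
  - have : r \in wnb W v by rewrite in_wnb cadjC rz.
    by rewrite nv !inE (negPf rv) (negPf rx1) (negPf rx2).
  - have : r \in wnb W x1 by rewrite in_wnb cadjC rz.
    by rewrite n1 !inE (negPf rv) (negPf rx1) (negPf ry1).
  have : r \in wnb W x2 by rewrite in_wnb cadjC rz.
  by rewrite n2 !inE (negPf rv) (negPf rx2) (negPf ry2).
apply: (@reducibleI W v v [:: r]); rewrite ?self // -/W1 /=.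
have y1r1 : y1 \in wnb W1 r by rewrite in_wnb W1y1 cadjC (adj _ _ y1r).
have := path_step lW1 W1r dr1 y1r1 _ dy1; rewrite eq_sym ry1 => /(_ isT).
by move: stepv n_cycle; clear; lia.
Qed.

(* What is gained by picking the middle vertex [c] of the path [p c q] that remains of the
   4-cycle [a p c q] after [a] has been dominated. *)
Definition centre_gain := G 3 0 + 2 * G 2 0 + E.

(** * Reductions at a 4-cycle of white vertices *)

Hypotheses (d_ge3 : 2 < d) (n_square : N <= G 3 0 + 2 * G 3 1 + E)
  (n_star3 : 2 * N <= 3 * G 3 2 + E + centre_gain)
  (n_star2 : 2 * N <= E + G 3 2 + G 2 1 + centre_gain)
  (n_star2' : 3 * N <= E + 2 * G 3 2 + 2 * centre_gain)
  (n_side : 2 * N <= 3 * E + 2 * G 3 1 + G 2 1 + 2 * G 2 0)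
  (n_diag : 2 * N <= 3 * E + 2 * G 3 2 + G 2 1 + 2 * G 1 0)
  (n_blue : N <= 3 * G 2 1 + E).

Lemma square_rot (W : {set T}) a p c q : square W a p c q -> square W p c q a.
Proof.
case=> us na np nc nq; split=> // [|x|x]; first by rewrite -(rot_uniq 1) in us.
  by rewrite np !inE [(x == a) || _]orbC.
by rewrite nq !inE [(x == a) || _]orbC.
Qed.

Lemma square_flip (W : {set T}) a p c q : square W a p c q -> square W a q c p.
Proof.
case=> us na np nc nq; split=> // [|x|x]; rewrite ?(na, nc) ?inE //.
- move: us; rewrite /= !inE !negb_or -!andbA => /and5P[ap ac aq pc /and3P[pq cq _]].
  by rewrite ap ac aq !(eq_sym q) (eq_sym c p) pc pq cq.
- by rewrite [(x == p) || _]orbC.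
by rewrite [(x == p) || _]orbC.
Qed.

Section Square.
Variables (W : {set T}) (a p c q : T).
Hypothesis sq : square W a p c q.

Lemma square_uniq : uniq [:: a; p; c; q]. Proof. by case: sq. Qed.

Lemma square_in x : x \in [:: a; p; c; q] -> x \in W.
Proof.
have [_ na _ nc _] := sq.
have inW u y : y \in wnb W u -> y \in W by rewrite in_wnb => /andP[].
rewrite !inE => /or4P[] /eqP->; [apply: (inW a) | apply: (inW a) | apply: (inW c) | apply: (inW a)].
all: by rewrite ?na ?nc !inE eqxx ?orbT.
Qed.

Lemma square_closed x y : x \in [:: a; p; c; q] -> y \in wnb W x -> y \in [:: a; p; c; q].
Proof.
have [_ na np nc nq] := sq.
by rewrite !inE => /or4P[] /eqP->; rewrite -in_wnb ?(na, np, nc, nq) !inE => /or3P[] ->; rewrite ?orbT.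
Qed.

Lemma square_wdeg x : x \in [:: a; p; c; q] -> wdeg W x = 3.
Proof.
have [us na np nc nq] := sq.
have card3 u s : wnb W u =i s -> uniq s -> size s = 3 -> wdeg W u = 3.
  by move=> nu /card_uniqP cs <-; rewrite -cs; apply: eq_card.
move: us; rewrite /= !inE !negb_or -!andbA => /and5P[ap ac aq pc /and3P[pq cq _]].
case/or4P=> /eqP->.
- by apply: card3 na _ _; rewrite //= !inE !negb_or ap aq pq.
- by apply: card3 np _ _; rewrite //= !inE !negb_or (eq_sym p a) ap ac pc.
- by apply: card3 nc _ _; rewrite //= !inE !negb_or (eq_sym c p) pc cq pq.
by apply: card3 nq _ _; rewrite //= !inE !negb_or !(eq_sym q) aq ac cq.
Qed.


Lemma square_adj : [/\ cadj a p, cadj a q, cadj p c & cadj c q].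
Proof.
have [_ na np nc _] := sq.
have adj u y : y \in wnb W u -> cadj u y by rewrite in_wnb => /andP[].
by split; apply: adj; rewrite ?na ?np ?nc !inE eqxx ?orbT.
Qed.

(** With [a] gone, [p c q] is a path, and [c] dominates all of it. The blue vertex [a] loses its
    last white neighbours [p] and [q], which accounts for [E]. *)
Lemma centre_step (V : {set T}) : V \subset W -> low V ->
  a \notin V -> p \in V -> c \in V -> q \in V ->
  weight (V :\: cnbhd c) + centre_gain <= weight V.
Proof.
move=> sV lV Va Vp Vc Vq; have [us na np nc nq] := sq; have [cap caq cpc ccq] := square_adj.
have sub x y : y \in wnb V x -> y \in wnb W x /\ y != a.
  rewrite !in_wnb => /andP[-> Vy]; rewrite (subsetP sV) //; split=> //.
  by apply: contraNneq Va => <-.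
have dp : wdeg V p <= 2.
  apply: (@wdeg_le_size _ _ [:: p; c]) => y /sub[]; rewrite np !inE => /or3P[] -> //.
  by rewrite orbT.
have dq : wdeg V q <= 2.
  apply: (@wdeg_le_size _ _ [:: q; c]) => y /sub[]; rewrite nq !inE => /or3P[] -> //.
  by rewrite orbT.
move: us; rewrite /= !inE !negb_or -!andbA => /and5P[ap ac aq pc /and3P[pq cq _]].
have := @low_drop V c [:: (c, (3, 0)); (p, (2, 0)); (q, (2, 0))] [:: a] lV.
rewrite /= !inE !negb_or (eq_sym c p) pc cq pq !cadjxx Vp Vc Vq (cadjC c) cpc ccq lV dp dq.
have -> : wdeg (V :\: cnbhd c) p <= 0.
  apply: (@wdeg_drop V c p [:: p; c]); rewrite //= ?inE ?pc //.
  by rewrite !cadjxx Vp Vc cpc (cadjC c) cpc.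
have -> : wdeg (V :\: cnbhd c) q <= 0.
  apply: (@wdeg_drop V c q [:: c; q]); rewrite //= ?inE ?cq //.
  by rewrite !cadjxx Vq Vc ccq (cadjC q) ccq.
rewrite wdeg_self (negPf Va) wdeg_red; last first.
  by move=> y /sub[]; rewrite na !inE => /or3P[] /eqP->; rewrite ?eqxx // ?ccq // cadjC cpc.
have -> : 0 < wdeg V a by apply/card_gt0P; exists p; rewrite in_wnb cap.
move=> /(_ isT isT isT isT); rewrite !big_cons big_nil /= /centre_gain; clear; lia.
Qed.

(** Picking [a] dominates every white neighbour of [z], so [z] adds [E] to the gains on the
    cycle. *)
Lemma square_corner z : low W -> z \notin W -> 0 < wdeg W z ->
  {subset wnb W z <= [:: a; p; q]} -> reducible W.
Proof.
move=> lW Wz dz sZ; have [us na np nc nq] := sq; have [cap caq cpc ccq] := square_adj.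
have [Wa Wp Wc Wq] : [/\ a \in W, p \in W, c \in W & q \in W].
  by split; apply: square_in; rewrite !inE eqxx ?orbT.
move: us; rewrite /= !inE !negb_or -!andbA => /and5P[ap ac aq pc /and3P[pq cq _]].
apply: (@reducibleI W a a [::]); first by rewrite in_wnb cadjxx.
have := @low_drop W a [:: (a, (3, 0)); (p, (3, 1)); (q, (3, 1))] [:: z] lW.
rewrite /= !inE !negb_or ap aq pq !cadjxx Wa Wp Wq cap caq !lW Wz dz.
have -> : wdeg (W :\: cnbhd a) p <= 1.
  apply: (@wdeg_drop W a p [:: a; p]); rewrite ?lW //= ?inE ?ap //.
  by rewrite !cadjxx Wa Wp cap (cadjC p) cap.
have -> : wdeg (W :\: cnbhd a) q <= 1.
  apply: (@wdeg_drop W a q [:: a; q]); rewrite ?lW //= ?inE ?aq //.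
  by rewrite !cadjxx Wa Wq caq (cadjC q) caq.
rewrite wdeg_self wdeg_red; last by move=> y /sZ; rewrite -na !inE => /andP[].
move=> /(_ isT isT isT isT); rewrite !big_cons big_nil /=; move: n_square; clear; lia.
Qed.

Section Blue.
Variable z : T.
Hypotheses (lW : low W) (Wz : z \notin W).
Let Z := wnb W z.
Let V := W :\: cnbhd z.

Let VW : V \subset W. Proof. exact: subsetDl. Qed.

Let lV : low V. Proof. exact: lowS lW. Qed.

Let V_out x : x \in Z -> x \notin V.
Proof. by rewrite in_wnb in_shrink => /andP[->]. Qed.

Let V_in x : x \in W -> x \notin Z -> x \in V.
Proof. by rewrite in_wnb in_shrink => ->; rewrite !andbT. Qed.

Lemma blue_drop x i : x \in Z -> wdeg W x <= i.+1 -> wdeg V x <= i.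
Proof.
rewrite in_wnb => /andP[zx Wx] dx; apply: (@wdeg_drop W z x [:: x]); rewrite ?addn1 //=.
by rewrite Wx zx cadjxx.
Qed.

Lemma blue_hit : 0 < wdeg W z -> [&& z \notin W, 0 < wdeg W z & wdeg V z == 0].
Proof. by rewrite Wz wdeg_self eqxx => ->. Qed.

(** The blue vertex [z] is picked first, which opens the cycle at [a], and then the centre [c] of
    the remaining path. *)
Lemma square_star3 : wdeg W z = 3 -> a \in Z -> p \notin Z -> c \notin Z -> q \notin Z ->
  reducible W.
Proof.
move=> dz Za Zp Zc Zq.
have [Wa Wp Wc Wq] : [/\ a \in W, p \in W, c \in W & q \in W].
  by split; apply: square_in; rewrite !inE eqxx ?orbT.
have [|r Zr] := @exists_notin Z [:: a]; first by rewrite [#|_|]dz.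
rewrite inE => ra; have [|t Zt] := @exists_notin Z [:: a; r]; first by rewrite [#|_|]dz.
rewrite !inE negb_or => /andP[ta tr].
apply: (@reducibleI W z a [:: c]) => //; rewrite -/V.
have cs := centre_step VW lV (V_out Za) (V_in Wp Zp) (V_in Wc Zc) (V_in Wq Zq).
have := @low_drop W z [:: (a, (3, 2)); (r, (3, 2)); (t, (3, 2))] [:: z] lW.
rewrite /= !mem_seq1 !in_cons !negb_or !(eq_sym a) ra ta (eq_sym r) tr Za Zr Zt !lW.
rewrite !blue_drop ?lW // blue_hit ?dz // => /(_ isT isT isT isT).
rewrite !big_cons big_nil /= -/V; move: cs n_star3; clear; lia.
Qed.

Lemma square_star2 r : wdeg W z = 2 -> a \in Z -> p \notin Z -> c \notin Z -> q \notin Z ->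
  r \in Z -> r != a -> wdeg W r <= 2 -> reducible W.
Proof.
move=> dz Za Zp Zc Zq Zr ra dr.
have [Wa Wp Wc Wq] : [/\ a \in W, p \in W, c \in W & q \in W].
  by split; apply: square_in; rewrite !inE eqxx ?orbT.
apply: (@reducibleI W z a [:: c]) => //; rewrite -/V.
have cs := centre_step VW lV (V_out Za) (V_in Wp Zp) (V_in Wc Zc) (V_in Wq Zq).
have := @low_drop W z [:: (a, (3, 2)); (r, (2, 1))] [:: z] lW.
rewrite /= !mem_seq1 (eq_sym a) ra Za Zr lW dr.
rewrite !blue_drop ?lW // blue_hit ?dz // => /(_ isT isT isT isT).
rewrite !big_cons big_nil /= -/V; move: cs n_star2; clear; lia.
Qed.

(** After [z], only the edge [c q] of the cycle is white, and picking [c] also takes the last white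
    neighbours of the blue vertices [a] and [p]. *)
Lemma square_side r : Z =i [:: a; p; r] -> r \notin [:: a; p; c; q] -> wdeg W r <= 2 ->
  reducible W.
Proof.
move=> ZE; rewrite !inE !negb_or => /and4P[ra rp rc rq] dr.
have [us na np nc nq] := sq; have [cap caq cpc ccq] := square_adj.
have [Wa Wp Wc Wq] : [/\ a \in W, p \in W, c \in W & q \in W].
  by split; apply: square_in; rewrite !inE eqxx ?orbT.
move: us; rewrite /= !inE !negb_or -!andbA => /and5P[ap ac aq pc /and3P[pq cq _]].
have [Za Zp Zr] : [/\ a \in Z, p \in Z & r \in Z] by rewrite !ZE !inE !eqxx !orbT.
have Zc : c \notin Z by rewrite ZE !inE !negb_or !(eq_sym c) ac pc rc.
have Zq : q \notin Z by rewrite ZE !inE !negb_or !(eq_sym q) aq pq rq.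
have [Vc Vq] := (V_in Wc Zc, V_in Wq Zq).
have [cza czp] : cadj z a /\ cadj z p.
  by move: Za Zp; rewrite !in_wnb => /andP[-> _] /andP[->].
have dz : 0 < wdeg W z by apply/card_gt0P; exists a.
have drop2 x y : x \in Z -> y \in Z -> x != y -> cadj x y -> wdeg V x <= 1.
  rewrite !in_wnb => /andP[zx Wx] /andP[zy Wy] xy cxy.
  by apply: (@wdeg_drop W z x [:: x; y]); rewrite ?lW //= ?inE ?xy // Wx Wy zx zy cadjxx cxy.
apply: (@reducibleI W z a [:: c]) => //; rewrite -/V.
have : weight V + (2 * G 3 1 + G 2 1 + E) <= weight W.
  have := @low_drop W z [:: (a, (3, 1)); (p, (3, 1)); (r, (2, 1))] [:: z] lW.
  rewrite /= !mem_seq1 !in_cons !negb_or !(eq_sym _ r) ra rp ap Za Zp Zr !lW dr blue_hit //.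
  rewrite (drop2 a p) // (drop2 p a) // 1?eq_sym // 1?cadjC // blue_drop // => /(_ isT isT isT isT).
  by rewrite !big_cons big_nil /= -/V; clear; lia.
have sub x y : y \in wnb V x -> [/\ y \in wnb W x, y != a & y != p].
  rewrite !in_wnb => /andP[-> Vy]; rewrite (subsetP VW) //; split=> //.
    by apply: contraNneq (V_out Za) => <-.
  by apply: contraNneq (V_out Zp) => <-.
have dc : wdeg V c <= 2.
  by apply: (@wdeg_drop W z c [:: p]); rewrite ?lW //= Wp czp cadjC cpc.
have dq : wdeg V q <= 2.
  by apply: (@wdeg_drop W z q [:: a]); rewrite ?lW //= Wa cza cadjC caq.
have := @low_drop V c [:: (c, (2, 0)); (q, (2, 0))] [:: a; p] lV.
rewrite /= !mem_seq1 ap cq !in_wnb cadjxx Vc Vq ccq dc dq wdeg_self !V_out //.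
have -> : wdeg (V :\: cnbhd c) q <= 0.
  apply: (@wdeg_drop V c q [:: c; q]); rewrite //= ?mem_seq1 ?cq //.
  by rewrite !cadjxx Vc Vq ccq (cadjC q) ccq.
have -> : 0 < wdeg V a by apply/card_gt0P; exists q; rewrite in_wnb caq.
have -> : 0 < wdeg V p by apply/card_gt0P; exists c; rewrite in_wnb cpc.
rewrite wdeg_red; last first.
  by move=> y /sub[]; rewrite na !inE => /or3P[] /eqP->; rewrite ?eqxx.
rewrite wdeg_red; last first.
  by move=> y /sub[]; rewrite np !inE => /or3P[] /eqP->; rewrite ?eqxx ?cadjxx.
move=> /(_ isT isT isT isT); rewrite !big_cons big_nil /=; move: n_side; clear; lia.
Qed.

(** After [z], the vertices [p] and [q] are isolated in the white graph; the blue vertex [a]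
    dominates both, and [a] and [c] lose their last white neighbours. *)
Lemma square_diag r : Z =i [:: a; c; r] -> r \notin [:: a; p; c; q] -> wdeg W r <= 2 ->
  reducible W.
Proof.
move=> ZE; rewrite !inE !negb_or => /and4P[ra rp rc rq] dr.
have [us na np nc nq] := sq; have [cap caq cpc ccq] := square_adj.
have [Wa Wp Wc Wq] : [/\ a \in W, p \in W, c \in W & q \in W].
  by split; apply: square_in; rewrite !inE eqxx ?orbT.
move: us; rewrite /= !inE !negb_or -!andbA => /and5P[ap ac aq pc /and3P[pq cq _]].
have [Za Zc Zr] : [/\ a \in Z, c \in Z & r \in Z] by rewrite !ZE !inE !eqxx !orbT.
have Zp : p \notin Z by rewrite ZE !inE !negb_or pc (eq_sym p a) (eq_sym p r) ap rp.
have Zq : q \notin Z by rewrite ZE !inE !negb_or !(eq_sym q) aq cq rq.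
have [Vp Vq] := (V_in Wp Zp, V_in Wq Zq).
have dz : 0 < wdeg W z by apply/card_gt0P; exists a.
apply: (@reducibleI W z a [:: a]) => //; rewrite -/V.
have : weight V + (2 * G 3 2 + G 2 1 + E) <= weight W.
  have := @low_drop W z [:: (a, (3, 2)); (c, (3, 2)); (r, (2, 1))] [:: z] lW.
  rewrite /= !mem_seq1 !in_cons !negb_or !(eq_sym _ r) ra rc ac Za Zc Zr !lW dr blue_hit //.
  rewrite !blue_drop ?lW // => /(_ isT isT isT isT).
  by rewrite !big_cons big_nil /= -/V; clear; lia.
have sub x y : y \in wnb V x -> [/\ y \in wnb W x, y != a & y != c].
  rewrite !in_wnb => /andP[-> Vy]; rewrite (subsetP VW) //; split=> //.
    by apply: contraNneq (V_out Za) => <-.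
  by apply: contraNneq (V_out Zc) => <-.
have dp : wdeg V p <= 1.
  by apply: (@wdeg_le_size _ _ [:: p]) => y /sub[]; rewrite np !inE => /or3P[] ->.
have dq : wdeg V q <= 1.
  by apply: (@wdeg_le_size _ _ [:: q]) => y /sub[]; rewrite nq !inE => /or3P[] ->.
have := @low_drop V a [:: (p, (1, 0)); (q, (1, 0))] [:: a; c] lV.
rewrite /= !mem_seq1 ac pq !in_wnb Vp Vq cap caq dp dq wdeg_self !V_out //.
have -> : wdeg (V :\: cnbhd a) p <= 0.
  by apply: (@wdeg_drop V a p [:: p]); rewrite //= Vp cap cadjxx.
have -> : wdeg (V :\: cnbhd a) q <= 0.
  by apply: (@wdeg_drop V a q [:: q]); rewrite //= Vq caq cadjxx.
have -> : 0 < wdeg V a by apply/card_gt0P; exists q; rewrite in_wnb caq.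
have -> : 0 < wdeg V c by apply/card_gt0P; exists q; rewrite in_wnb ccq.
rewrite wdeg_red; last first.
  by move=> y /sub[]; rewrite nc !inE => /or3P[] /eqP->; rewrite ?eqxx ?cap ?caq.
move=> /(_ isT isT isT isT); rewrite !big_cons big_nil /=; move: n_diag; clear; lia.
Qed.

End Blue.
End Square.

(** Both cycles are components of the white graph, so a common vertex would put [r] on the first
    one. *)
Lemma square_disjoint (W : {set T}) a p c q r p' c' q' x :
  square W a p c q -> square W r p' c' q' -> r \notin [:: a; p; c; q] ->
  x \in [:: a; p; c; q] -> x \notin [:: r; p'; c'; q'].
Proof.
move=> sC sR nr Cx; have closed := square_closed sC; have [_ nR np' nc' nq'] := sR.
have np : p' \notin [:: a; p; c; q].
  by apply: contra nr => /closed; apply; rewrite np' !inE eqxx !orbT.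
have nq : q' \notin [:: a; p; c; q].
  by apply: contra nr => /closed; apply; rewrite nq' !inE eqxx !orbT.
have nc : c' \notin [:: a; p; c; q].
  by apply: contra np => /closed; apply; rewrite nc' !inE eqxx !orbT.
by apply/negP; rewrite !inE => /or4P[] /eqP xE; move: nr np nq nc; rewrite -xE Cx.
Qed.

(** Picking [z] opens both cycles, at [a] and at [r]; the centres [c] and [c'] of the two remaining
    paths complete the three picks. *)
Lemma two_squares_star2 (W : {set T}) a p c q r p' c' q' z :
  low W -> z \notin W -> wdeg W z = 2 -> square W a p c q -> square W r p' c' q' ->
  r \notin [:: a; p; c; q] -> a \in wnb W z -> r \in wnb W z -> reducible W.
Proof.
move=> lW Wz dz sC sR nr Za Zr.
have disj x (Cx : x \in [:: a; p; c; q]) := square_disjoint sC sR nr Cx.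
have ra : r != a by apply: contraNneq nr => ->; rewrite mem_head.
have ZE : wnb W z =i [:: a; r].
  apply: uniq_eq_card; rewrite ?[#|_|]dz //= ?mem_seq1 1?eq_sym ?ra //.
  by move=> x; rewrite in_cons mem_seq1 => /orP[] /eqP->.
have nZ x : x \in W -> x != a -> x != r -> x \in W :\: cnbhd z.
  move=> Wx xa xr; have : x \notin wnb W z by rewrite ZE !inE (negPf xa) (negPf xr).
  by rewrite in_wnb in_shrink Wx !andbT.
have cC x : x \in [:: p; c; q] -> x \in W :\: cnbhd z.
  move=> Cx; have Cx' : x \in [:: a; p; c; q] by rewrite in_cons Cx orbT.
  apply: nZ; first exact: square_in Cx'.
    by apply: contraTneq Cx => ->; have := square_uniq sC; case/andP.
  by apply: contraNneq nr => <-.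
have Va : a \notin W :\: cnbhd z by move: Za; rewrite in_wnb in_shrink => /andP[->].
have Vr : r \notin W :\: cnbhd z by move: Zr; rewrite in_wnb in_shrink => /andP[->].
set V := W :\: cnbhd z in nZ cC Va Vr; have sV : V \subset W by exact: subsetDl.
have lV : low V by exact: lowS lW.
have [] : [/\ p \in V, c \in V & q \in V] by split; apply: cC; rewrite !inE eqxx ?orbT.
move=> Vp Vc Vq; have cs1 := centre_step sC sV lV Va Vp Vc Vq.
have cR x : x \in [:: p'; c'; q'] -> x \in V :\: cnbhd c.
  move=> Rx; have Rx' : x \in [:: r; p'; c'; q'] by rewrite in_cons Rx orbT.
  have Wx : x \in W by exact: square_in Rx'.
  have nCx : x \notin [:: a; p; c; q] by apply/negP=> /disj; rewrite Rx'.
  have xa : x != a by apply: contraNneq nCx => ->; rewrite mem_head.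
  have xr : x != r by apply: contraTneq Rx => ->; have := square_uniq sR; case/andP.
  rewrite in_shrink nZ // andbT; apply: contra nCx => cx; apply: (square_closed sC (x := c)).
    by rewrite !inE eqxx !orbT.
  by rewrite in_wnb cx.
have [] : [/\ p' \in V :\: cnbhd c, c' \in V :\: cnbhd c & q' \in V :\: cnbhd c].
  by split; apply: cR; rewrite !in_cons eqxx ?orbT.
have sV2 : V :\: cnbhd c \subset V by exact: subsetDl.
have Vr2 : r \notin V :\: cnbhd c by apply: contra Vr; exact: (subsetP sV2).
move=> Vp' Vc' Vq'.
have cs2 := centre_step sR (subset_trans sV2 sV) (lowS sV2 lV) Vr2 Vp' Vc' Vq'.
apply: (@reducibleI W z a [:: c; c']) => //=; rewrite -/V.
have := @low_drop W z [:: (a, (3, 2)); (r, (3, 2))] [:: z] lW.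
rewrite /= !mem_seq1 eq_sym ra Za Zr !lW !blue_drop ?lW // blue_hit ?dz //.
move=> /(_ isT isT isT isT); rewrite !big_cons big_nil /= -/V.
by move: cs1 cs2 n_star2'; clear; lia.
Qed.

Lemma wnb_eq3 (W : {set T}) z x y r : low W -> uniq [:: x; y; r] ->
  x \in wnb W z -> y \in wnb W z -> r \in wnb W z -> wnb W z =i [:: x; y; r].
Proof.
move=> lW us Zx Zy Zr; apply: uniq_eq_card us _ (lW z) => u.
by rewrite !in_cons orbF => /or3P[] /eqP->.
Qed.

(** If [r] has white degree 3, it lies on a 4-cycle of its own unless [W] is reducible. That cycle
    meets the neighbourhood of [z] only in [r], so [square_star3] applies to it. *)
Lemma square_touch2 (W : {set T}) a p c q z x y r :
  low W -> z \notin W -> square W a p c q -> wnb W z =i [:: x; y; r] ->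
  x \in [:: a; p; c; q] -> y \in [:: a; p; c; q] -> r \notin [:: a; p; c; q] ->
  r \in W -> wdeg W z = 3 -> (wdeg W r <= 2 -> reducible W) -> reducible W.
Proof.
move=> lW Wz sC ZE Cx Cy nr Wr dz red2.
have [/red2 // | dr] := leqP (wdeg W r) 2.
have dr3 : wdeg W r = 3 by apply/eqP; rewrite eqn_leq lW.
have [// | [p' [c' [q' sR]]]] := deg3_square lW Wr dr3.
have Zr : r \in wnb W z by rewrite ZE !inE eqxx !orbT.
have nZ t : t \in [:: p'; c'; q'] -> t \notin wnb W z.
  move=> Rt; have Rt' : t \in [:: r; p'; c'; q'] by rewrite in_cons Rt orbT.
  rewrite ZE !inE; apply/negP=> /or3P[] /eqP tE.
  - by have := square_disjoint sC sR nr Cx; rewrite -tE Rt'.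
  - by have := square_disjoint sC sR nr Cy; rewrite -tE Rt'.
  by have := square_uniq sR; rewrite -tE cons_uniq Rt.
apply: (square_star3 sR lW Wz dz Zr); apply: nZ; rewrite !inE eqxx ?orbT //.
Qed.

Lemma square_reducible (W : {set T}) a p c q : low W -> square W a p c q -> reducible W.
Proof.
move=> lW sC.
have da : wdeg W a = 3 by apply: (square_wdeg sC); rewrite mem_head.
(* Since [d] is at least 3, the corner [a] has a blue neighbour [z]; the cases depend on where the
   white neighbours of [z] lie. *)
have /card_gt0P[z] : 0 < #|cnbhd a :\: W| by rewrite card_blue da; move: d_ge3; clear; lia.
rewrite in_setD inE => /andP[Wz az].
have Wa : a \in W by apply: (square_in sC); rewrite mem_head.
have Za : a \in wnb W z by rewrite in_wnb cadjC az.
have dz0 : 0 < wdeg W z by apply/card_gt0P; exists a.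
have [/subsetP sZ | /subsetPn[r Zr nr]] := boolP (wnb W z \subset [:: a; p; c; q]).
  (* Having at most three white neighbours, [z] misses a corner [k]; the cycle is rotated so that
     the corner opposite [k] is picked. *)
  have [k Ck nk] : exists2 k, k \in [:: a; p; c; q] & k \notin wnb W z.
    apply/allPn/negP=> /allP sC'; have := uniq_leq_card (square_uniq sC) sC'.
    by rewrite leqNgt ltnS lW.
  have sub s : {subset [:: a; p; c; q] <= k :: s} -> {subset wnb W z <= s}.
    move=> sub x Zx; have := sub x (sZ x Zx).
    by rewrite in_cons; case: eqVneq => // xk; rewrite -xk Zx in nk.
  have sCr := square_rot sC; have sCrr := square_rot sCr; have sCrrr := square_rot sCrr.
  move: Ck; rewrite !inE => /or4P[] /eqP kE.
  - apply: (square_corner sCrr lW Wz dz0); apply: sub => x.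
    by rewrite kE !inE => /or4P[] ->; rewrite ?orbT.
  - apply: (square_corner sCrrr lW Wz dz0); apply: sub => x.
    by rewrite kE !inE => /or4P[] ->; rewrite ?orbT.
  - apply: (square_corner sC lW Wz dz0); apply: sub => x.
    by rewrite kE !inE => /or4P[] ->; rewrite ?orbT.
  apply: (square_corner sCr lW Wz dz0); apply: sub => x.
  by rewrite kE !inE => /or4P[] ->; rewrite ?orbT.
have Wr : r \in W by move: Zr; rewrite in_wnb => /andP[].
have ra : r != a by apply: contraNneq nr => ->; rewrite mem_head.
have touch x : x \in [:: p; c; q] -> x \in wnb W z ->
    (wnb W z =i [:: a; x; r] -> wdeg W r <= 2 -> reducible W) -> reducible W.
  move=> Cx Zx red2; have Cx' : x \in [:: a; p; c; q] by rewrite in_cons Cx orbT.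
  have xr : x != r by apply: contraNneq nr => <-.
  have xa : x != a by apply: contraTneq Cx => ->; have := square_uniq sC; case/andP.
  have us : uniq [:: a; x; r] by rewrite /= !inE negb_or (eq_sym a x) xa (eq_sym a r) ra xr.
  have ZE := wnb_eq3 lW us Za Zx Zr.
  apply: (square_touch2 lW Wz sC ZE _ Cx' nr Wr); [by rewrite mem_head | | exact: red2].
  by apply/eqP; rewrite eqn_leq lW (uniq_leq_card us) // => y; rewrite ZE.
have nrf : r \notin [:: a; q; c; p].
  by move: nr; rewrite !inE !negb_or => /and4P[-> -> -> ->].
have [Zp | Zp] := boolP (p \in wnb W z).
  apply: (touch p) => // [|ZE dr]; first by rewrite !inE eqxx.
  exact: (square_side sC lW Wz ZE).
have [Zq | Zq] := boolP (q \in wnb W z).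
  apply: (touch q) => // [|ZE dr]; first by rewrite !inE eqxx !orbT.
  exact: (square_side (square_flip sC) lW Wz ZE).
have [Zc | Zc] := boolP (c \in wnb W z).
  apply: (touch c) => // [|ZE dr]; first by rewrite !inE eqxx !orbT.
  exact: (square_diag sC lW Wz ZE).
(* Now [a] is the only vertex of the cycle adjacent to [z]. *)
have [dz | dz] := leqP (wdeg W z) 2; last first.
  by apply: (square_star3 sC lW Wz) => //; apply/eqP; rewrite eqn_leq lW.
have dz2 : wdeg W z = 2.
  apply/eqP; rewrite eqn_leq dz; apply: (@uniq_leq_card _ [:: a; r]).
    by rewrite /= mem_seq1 eq_sym ra.
  by move=> x; rewrite !in_cons orbF => /orP[] /eqP->.
have [dr | dr] := leqP (wdeg W r) 2; first exact: (square_star2 sC lW Wz dz2 Za Zp Zc Zq Zr).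
have dr3 : wdeg W r = 3 by apply/eqP; rewrite eqn_leq lW.
have [// | [p' [c' [q' sR]]]] := deg3_square lW Wr dr3.
exact: (two_squares_star2 lW Wz dz2 sC sR).
Qed.

Lemma blue3_reducible (W : {set T}) z : low W -> z \notin W -> wdeg W z = 3 ->
  (forall x, x \in W -> wdeg W x <= 2) -> reducible W.
Proof.
move=> lW Wz dz dW.
have [|x Zx _] := @exists_notin (wnb W z) [::]; first by rewrite [#|_|]dz.
have [|y Zy] := @exists_notin (wnb W z) [:: x]; first by rewrite [#|_|]dz.
rewrite mem_seq1 => yx.
have [|t Zt] := @exists_notin (wnb W z) [:: x; y]; first by rewrite [#|_|]dz.
rewrite !inE negb_or => /andP[tx ty]; apply: (@reducibleI W z x [::]) => //=.
have dZ u : u \in wnb W z -> wdeg W u <= 2 by rewrite in_wnb => /andP[_ /dW].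
have := @low_drop W z [:: (x, (2, 1)); (y, (2, 1)); (t, (2, 1))] [:: z] lW.
rewrite /= !mem_seq1 !in_cons !negb_or !(eq_sym x) yx tx (eq_sym y) ty Zx Zy Zt !dZ //.
rewrite !blue_drop ?dZ // blue_hit ?dz // => /(_ isT isT isT isT).
by rewrite !big_cons big_nil /=; move: n_blue; clear; lia.
Qed.

Hypotheses (b21 : b 2 <= 2 * b 1) (n_single : N <= w + d * b 1)
  (n_pair : 2 * N <= 4 * w + d.-1 * b 2 + d.-1 * (2 * (b 2 - b 1)))
  (n_pair' : 2 * N <= 4 * w + d * (2 * (b 2 - b 1)) + (d - 2) * b 2).

Lemma low_reducible (W : {set T}) : low W -> reducible W \/ covered N W (weight W).
Proof.
move=> lW.
have [/exists_inP[v Wv /eqP dv] | no3] := boolP [exists v in W, wdeg W v == 3].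
  left; have [// | [p [c [q sC]]]] := deg3_square lW Wv dv; exact: square_reducible sC.
have dW x : x \in W -> wdeg W x <= 2.
  move=> Wx; have := lW x; rewrite leq_eqVlt => /orP[dx|//].
  by case/negP: no3; apply/exists_inP; exists x.
have [/existsP[z /eqP dz] | no3'] := boolP [exists z, wdeg W z == 3].
  left; apply: (blue3_reducible (z := z)) => //.
  by apply/negP=> /dW; rewrite dz.
right; apply: matching_covered => // [|x]; first by apply: leq_trans d_ge3.
have := lW x; rewrite leq_eqVlt => /orP[dx|//].
by case/negP: no3'; apply/existsP; exists x.
Qed.

(** * Reductions at vertices with many undominated neighbours *)

Variable dh : nat.
Hypotheses (slope_high : has_slope dh d.-1)
  (n_white : forall j, 3 < j <= d.+1 ->
     N <= w + dh * (d.+1 - j) + j.-1 * (w + dh * (d.+1 - j) - b (j - 2)))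
  (n_high : forall j, 3 < j < d -> N <= j * (w + dh * (d - 2) - b 2) + (b j - dh * j)).

(* Every dominated vertex is picked or adjacent to a picked one, so it has at most [d - 1]
   white neighbours. *)
Definition good (W : {set T}) := forall y, y \notin W -> wdeg W y <= d.-1.

(** A newly dominated [y] other than [v] has two vertices of its closed neighbourhood outside the
    new set, namely [y] and [v]. *)
Lemma good_step (W : {set T}) v : good W -> good (W :\: cnbhd v).
Proof.
move=> gW y; rewrite in_shrink negb_and negbK.
have [Wy | nWy _] := boolP (y \in W); last first.
  by apply: leq_trans (gW y nWy); apply: wdegS; exact: subsetDl.
rewrite orbF => vy; have [-> | yv] := eqVneq y v; first by rewrite wdeg_self.
have : [set y; v] \subset cnbhd y :\: (W :\: cnbhd v).
  by apply/subsetP=> x; rewrite !inE => /orP[] /eqP->; rewrite ?vy ?cadjxx //= cadjC.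
by move/subset_leq_card; rewrite cards2 yv card_blue; clear; lia.
Qed.

Lemma good_shrink (W : {set T}) s : good W -> good (shrink W s).
Proof. by elim: s W => //= v s IHs W gW; apply: IHs; exact: good_step. Qed.

Lemma leq_sum_const (s : seq T) (F : T -> nat) k :
  {in s, forall x, k <= F x} -> size s * k <= \sum_(x <- s) F x.
Proof.
by move=> leF; rewrite -sum1_size big_distrl /=; apply: leq_sum_in => x /leF; rewrite mul1n.
Qed.

(** Each white neighbour [x] of [v] loses both [v] and itself, going from at most [j] to at most
    [j - 2], and [v] drops to 0. The slope [dh] is valid up to [d.-1], the largest white degree of a
    blue vertex of a good set. *)
Lemma white_reducible (W : {set T}) v : good W -> v \in W ->
  (forall x, x \in W -> wdeg W x <= wdeg W v) -> 3 < wdeg W v -> reducible W.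
Proof.
move=> gW Wv max_v dv; set j := wdeg W v in max_v dv.
have vv : v \in wnb W v by rewrite in_wnb cadjxx.
have dj : j <= d.+1 by rewrite -(card_cnbhd v) subset_leq_card // subsetIl.
apply: (@reducibleI W v v [::]) => //=; pose s := enum (wnb W v :\ v).
have us : uniq (v :: s) by rewrite /= enum_uniq mem_enum !inE eqxx.
have sA : {subset v :: s <= wnb W v}.
  by move=> x; rewrite in_cons mem_enum in_setD1 => /orP[/eqP->|/andP[]].
have size_s : size s = j.-1 by rewrite -cardE /j /wdeg [in RHS](cardsD1 v) vv.
have tW : {subset [::] <= ~: W} by [].
apply: leq_trans (weight_drop slope_high gW us sA (isT : uniq [::]) tW).
rewrite big_nil addn0 muln1 leq_add2l big_cons.
have rng : 3 < j <= d.+1 by rewrite dv dj.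
apply: leq_trans (n_white rng) _.
apply: leq_add.
  have := gain_ge dh (leqnn j) (eq_leq (wdeg_self W v)).
  by rewrite b0 subn0.
rewrite -size_s; apply: leq_sum_const => x; rewrite mem_enum in_setD1 => /andP[xv vx].
have [cvx Wx] : cadj v x /\ x \in W by move: vx; rewrite in_wnb => /andP[].
apply: gain_ge; first exact: max_v.
apply: (@wdeg_drop W v x [:: v; x]) => /=; first by rewrite inE eq_sym xv.
  by rewrite !cadjxx Wv Wx cvx cadjC cvx.
by have := max_v x Wx; move: dv; clear; lia.
Qed.

(** Picking the blue vertex [z] lowers each of its white neighbours from at most 3 to at most 2, and
    [z] itself contributes [b j - dh * j] with [j = wdeg W z]. *)
Lemma high_reducible (W : {set T}) z : good W -> z \notin W ->
  (forall x, x \in W -> wdeg W x <= 3) -> 3 < wdeg W z -> reducible W.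
Proof.
move=> gW Wz dW dz; pose s := enum (wnb W z).
have dzd := gW z Wz.
have /card_gt0P[x0 Zx0] : 0 < #|wnb W z| by apply: leq_trans dz.
apply: (@reducibleI W z x0 [::]) => //=.
have us : uniq s by exact: enum_uniq.
have sA : {subset s <= wnb W z} by move=> x; rewrite mem_enum.
have tW : {subset [:: z] <= ~: W} by move=> x; rewrite mem_seq1 inE => /eqP->.
apply: leq_trans (weight_drop slope_high gW us sA (isT : uniq [:: z]) tW).
rewrite muln1 -addnA leq_add2l big_seq1.
have rng : 3 < wdeg W z < d by rewrite dz /=; move: dzd d_ge3; clear; lia.
apply: leq_trans (n_high rng) _.
apply: leq_add; last first.
  rewrite /extra wdeg_self b0 subn0; have := wdeg_split W z z.
  by rewrite wdeg_self add0n => <-.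
rewrite [X in X * _](_ : _ = size s); last by rewrite -cardE.
apply: leq_sum_const => x; rewrite mem_enum in_wnb => /andP[zx Wx].
have -> : d - 2 = d.+1 - 3 by [].
apply: gain_ge; first exact: dW.
by apply: (@wdeg_drop W z x [:: x]); rewrite //= ?dW // Wx zx cadjxx.
Qed.

Lemma shrink_covered (W : {set T}) s c :
  covered N (shrink W s) c -> covered N W (c + N * size s).
Proof.
elim: s W c => [|v s IHs] W c /=; first by rewrite muln0 addn0.
move=> /IHs[S SV le_c]; exists (v |: S) => [x Wx|].
  have [vx | vx] := boolP (cadj v x); first by exists v; rewrite ?setU11 // cadjC.
  have [|y Sy xy] := SV x; first by rewrite in_shrink vx.
  by exists y; rewrite // setU1r.
apply: leq_trans (_ : N * (#|S|.+1) <= _).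
  by rewrite leq_mul2l cardsU1 -add1n leq_add2r leq_b1 orbT.
by rewrite !mulnS; move: le_c; clear; lia.
Qed.

(** Induction on [#|W|], each picked vertex being paid for by [N]. White vertices of degree above 3
    are treated before blue ones because [high_reducible] relies on the bound 3 for white
    vertices. *)
Lemma good_covered (W : {set T}) : good W -> covered N W (weight W).
Proof.
have [n] := ubnP #|W|; elim: n W => // n IHn W; rewrite ltnS => leW gW.
suff [[s sW le_w] | //] : reducible W \/ covered N W (weight W).
  have [S SW le_S] : covered N W (weight (shrink W s) + N * size s).
    apply: shrink_covered; apply: IHn; last exact: good_shrink.
    exact: leq_trans (proper_card sW) leW.
  by exists S => //; exact: leq_trans le_w.
have [/exists_inP[v0 Wv0 dv0] | no4] := boolP [exists v in W, 3 < wdeg W v].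
  left; case: (@arg_maxnP _ v0 (mem W) (wdeg W) Wv0) => v Wv max_v.
  apply: (white_reducible gW Wv max_v); exact: leq_trans (max_v v0 Wv0).
have dW x : x \in W -> wdeg W x <= 3.
  by move=> Wx; rewrite leqNgt; apply: contra no4 => dx; apply/exists_inP; exists x.
have [/existsP[z /andP[Wz dz]] | no4'] := boolP [exists z, (z \notin W) && (3 < wdeg W z)].
  by left; apply: (high_reducible gW Wz).
apply: low_reducible => y; have [/dW // | Wy] := boolP (y \in W).
by rewrite leqNgt; apply: contra no4' => dy; apply/existsP; exists y; rewrite Wy.
Qed.

Lemma dominating_set_exists : exists2 S, dominating e S & N * #|S| <= w * #|T|.
Proof.
have [|S SW le_S] := @good_covered setT; first by move=> y; rewrite inE.
exists S.
  apply/forallP=> x; apply/implyP=> Sx; have [|y Sy] := SW x; first by rewrite inE.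
  by case/predU1P=> [xy | xy]; [rewrite xy Sy in Sx | apply/exists_inP; exists y].
by apply: leq_trans le_S _; rewrite /weight setCT big_set0 addn0 cardsT.
Qed.

End Potential.

(** * Weights for degrees 3, 4 and 5 *)

(* The weights solve the linear inequalities required by the reductions. *)
Lemma cubic_domination (T : finType) (e : rel T) : simple_graph e -> regular e 3 ->
  exists2 S, dominating e S & 12 * #|S| <= 5 * #|T|.
Proof.
(* The default 9 repeats the last entry, so [b] is constant from 3 on. *)
move=> [e_sym e_irr] ereg; pose b := nth 9 [:: 0; 7; 8; 9].
suff [S domS le_S] : exists2 S, dominating e S & 36 * #|S| <= 15 * #|T|.
  by exists S => //; move: le_S; clear; lia.
(* The numbers are [w = 15], [N = 36], [dl = 1], [E = 6] and, at the end, [dh = 1]; the ratio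
   [w / N] is 5/12. *)
apply: (@dominating_set_exists T e 3 e_sym e_irr ereg 15 b _ _ _ 36 1 6 _ _ _ _ _ _
  _ _ _ _ _ _ _ _ _ _ _ _ 1) => //.
- by move=> [|[|[|[|i]]]] [|[|[|[|j]]]] //; rewrite /b /= ?nth_nil ?nth_nil.
- by move=> [|[|[|[|i]]]] //; rewrite /b /= nth_nil.
- by move=> [|[|[|[|i]]]] [|[|[|[|j]]]].
- by move=> [|[|[|[|i]]]].
- by move=> [|[|[|i]]] [|[|[|j]]].
- by move=> [|[|[|[|[|j]]]]].
by move=> [|[|[|[|j]]]].
Qed.

Lemma quartic_domination (T : finType) (e : rel T) : simple_graph e -> regular e 4 ->
  exists2 S, dominating e S & 5 * #|S| <= 2 * #|T|.
Proof.
move=> [e_sym e_irr] ereg; pose b := nth 5 [:: 0; 3; 4; 5].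
suff [S domS le_S] : exists2 S, dominating e S & 20 * #|S| <= 8 * #|T|.
  by exists S => //; move: le_S; clear; lia.
apply: (@dominating_set_exists T e 4 e_sym e_irr ereg 8 b _ _ _ 20 1 2 _ _ _ _ _ _
  _ _ _ _ _ _ _ _ _ _ _ _ 1) => //.
- by move=> [|[|[|[|i]]]] [|[|[|[|j]]]] //; rewrite /b /= ?nth_nil ?nth_nil.
- by move=> [|[|[|[|i]]]] //; rewrite /b /= nth_nil.
- by move=> [|[|[|[|i]]]] [|[|[|[|j]]]].
- by move=> [|[|[|[|i]]]].
- by move=> [|[|[|[|i]]]] [|[|[|[|j]]]].
- by move=> [|[|[|[|[|[|j]]]]]].
by move=> [|[|[|[|j]]]].
Qed.

Lemma quintic_domination (T : finType) (e : rel T) : simple_graph e -> regular e 5 ->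
  exists2 S, dominating e S & 3 * #|S| <= #|T|.
Proof.
move=> [e_sym e_irr] ereg; pose b := nth 33 [:: 0; 22; 26; 30; 33].
suff [S domS le_S] : exists2 S, dominating e S & 165 * #|S| <= 55 * #|T|.
  by exists S => //; move: le_S; clear; lia.
(* Here the two slopes differ: [dl = 4] is the increment of [b] up to 3, and [dh = 3] the one from 3
   to 4. *)
apply: (@dominating_set_exists T e 5 e_sym e_irr ereg 55 b _ _ _ 165 4 18 _ _ _ _ _ _
  _ _ _ _ _ _ _ _ _ _ _ _ 3) => //.
- by move=> [|[|[|[|[|i]]]]] [|[|[|[|[|j]]]]] //; rewrite /b /= ?nth_nil ?nth_nil.
- by move=> [|[|[|[|[|i]]]]] //; rewrite /b /= nth_nil.
- by move=> [|[|[|[|i]]]] [|[|[|[|j]]]].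
- by move=> [|[|[|[|i]]]].
- by move=> [|[|[|[|[|i]]]]] [|[|[|[|[|j]]]]].
- by move=> [|[|[|[|[|[|[|j]]]]]]].
by move=> [|[|[|[|[|j]]]]].
Qed.

(** * Domination numbers and covers *)

Lemma domination_number_le (T : finType) (e : rel T) (S : {set T}) :
  dominating e S -> domination_number e <= #|S|.
Proof.
move=> domS; rewrite /domination_number.
have: S \in index_enum {set T} by rewrite mem_index_enum.
elim: (index_enum _) => // R s IHs; rewrite in_cons big_cons => /predU1P[<- | /IHs le_S].
  by rewrite domS geq_minl.
by case: ifP => // _; rewrite geq_min le_S orbT.
Qed.

Lemma domination_number_ge (T : finType) (e : rel T) d :
  symmetric e -> regular e d -> #|T| <= d.+1 * domination_number e.
Proof.
move=> e_sym ereg; rewrite /domination_number.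
apply: (big_ind (fun m => #|T| <= d.+1 * m)) => [|m n le_m le_n|S /forallP domS].
- by rewrite leq_pmull.
- by rewrite /minn; case: ifP.
have cov x : exists2 y, y \in S & (y == x) || e x y.
  have [Sx | nSx] := boolP (x \in S); first by exists x; rewrite ?eqxx.
  by have /implyP/(_ nSx)/exists_inP[y Sy xy] := domS x; exists y; rewrite ?xy ?orbT.
rewrite -cardsT mulnC -sum_nat_const.
apply: leq_trans (_ : #|\bigcup_(y in S) (y |: nbhd e y)| <= _).
  apply/subset_leq_card/subsetP=> x _; have [y Sy xy] := cov x.
  by apply/bigcupP; exists y; rewrite // !inE e_sym eq_sym.
apply: leq_trans (_ : \sum_(y in S) #|y |: nbhd e y| <= _).
  elim/big_rec2: _ => [|y A m Sy le_m]; first by rewrite cards0.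
  by apply: leq_trans (leq_card_setU _ _) _; rewrite leq_add2l.
by apply: leq_sum => y _; rewrite cardsU1 ereg -add1n leq_add2r leq_b1.
Qed.

Lemma cover_regular (TG TF : finType) (eG : rel TG) (eF : rel TF) pi d :
  cover_map eG eF pi -> regular eF d -> regular eG d.
Proof.
by move=> [_ cov] regF v; have [inj im] := cov v; rewrite -(card_in_imset inj) im regF.
Qed.

Lemma kfold_card (TG TF : finType) (pi : TG -> TF) k : kfold pi k -> #|TG| = k * #|TF|.
Proof.
move=> fold; rewrite -sum1_card (partition_big pi predT) //= mulnC -sum_nat_const.
by apply: eq_bigr => u _; rewrite sum1dep_card fold.
Qed.

Theorem theorem2p6 (TF TG : finType) (eF : rel TF) (eG : rel TG)
  (pi : TG -> TF) (k : nat) :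
  simple_graph eF -> simple_graph eG ->
  cover_map eG eF pi -> kfold pi k ->
  (regular eF 3 -> 5 * domination_number eG >= 3 * (k * domination_number eF))
  /\
  (regular eF 4 \/ regular eF 5 ->
     2 * domination_number eG >= k * domination_number eF).
Proof.
move=> sF [eG_sym _] cov fold; have cardG := kfold_card fold.
have lower d : regular eF d -> k * #|TF| <= d.+1 * domination_number eG.
  by move=> regF; rewrite -cardG; apply: domination_number_ge (cover_regular cov regF).
have scale a c S : dominating eF S -> a * #|S| <= c * #|TF| ->
    a * (k * domination_number eF) <= c * (k * #|TF|).
  move=> domS le_S; rewrite !(mulnCA _ k) leq_mul2l; apply/orP; right.
  by apply: leq_trans le_S; rewrite leq_mul2l domination_number_le ?orbT.
(* Each case chains [scale] with [lower]; for degree 3, [12 k] times the domination number of [F] is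
   at most [5 k #|TF|], hence at most 20 times that of [G]. *)
split=> [reg3 | [reg4 | reg5]].
- have [S domS /(scale _ _ _ domS)] := cubic_domination sF reg3.
  by have := lower _ reg3; lia.
- have [S domS /(scale _ _ _ domS)] := quartic_domination sF reg4.
  by have := lower _ reg4; lia.
have [S domS] := quintic_domination sF reg5; rewrite -{1}[#|TF|]mul1n => /(scale _ _ _ domS).
by have := lower _ reg5; lia.
Qed.
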